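(* Let the state space $E$ be countable. Then a global Markovian randomized equilibrium $(p^{(1)},p^{(2)})$ exists.
   Context: Setting. $X=(X_n)_{n\in\mathbb{N}_0}$ is a homogeneous Markov process with state space $E$ (countable $E$ carries the discrete $\sigma$-algebra) and Markov kernel $\Pi$; under $\mathbb{P}_x$ (expectation $\mathbb{E}_x$) it starts at $X_0=x\in E$. The discount factor $\alpha\in(0,1)$ is constant and $f_i,g_i,h_i:E\to\mathbb{R}$, $i=1,2$, are measurable. The probability space supports two sequences $(\xi^{(i)}_n)_{n\in\mathbb{N}_0}$, $i=1,2$, of iid uniform $(0,1)$ random variables, independent of $X$ and of each other. Killed process. $\tilde X$ is the process $X$ killed at each time step with probability $1-\alpha$ (independently of everything else): $\tilde X_n=X_n$ for $n\le T$ and $\tilde X_n=K$ for $n>T$, where $\mathbb{P}(T=k)=(1-\alpha)\alpha^k$, $k\in\mathbb{N}_0$, and $K$ is an absorbing cemetery state at which all functions take the value $0$. Standing integrability assumption. For $i=1,2$ and under every $\mathbb{P}_x$: $\sup_{n}|f_i(\tilde X_n)|,\ \sup_{n}|g_i(\tilde X_n)|,\ \sup_{n}|h_i(\tilde X_n)|\in L^1$. Stopping times. $\mathcal{T}_i$ is the set of ($\mathbb{N}_0\cup\{\infty\}$-valued) stopping times with respect to the filtration $\sigma(X_0,\dots,X_n,\xi^{(i)}_0,\dots,\xi^{(i)}_n)$, $n\in\mathbb{N}_0$. For measurable $p^{(i)}:E\to[0,1]$, the Markovian randomized stopping time of player $i$ is $\tau^{p^{(i)}}=\inf\{n\in\mathbb{N}_0:\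 p^{(i)}(X_n)\ge\xi^{(i)}_n\}$ ($\inf\emptyset=\infty$); it is identified with $p^{(i)}$. Rewards. For $\tau_1\in\mathcal{T}_1,\tau_2\in\mathcal{T}_2$ and $i,j\in\{1,2\}$, $j\neq i$, $$J_i(x;\tau_1,\tau_2)=\mathbb{E}_x\big[\alpha^{\tau_i}f_i(X_{\tau_i})\mathbb{I}_{\{\tau_i<\tau_j\}}+\alpha^{\tau_j}g_i(X_{\tau_j})\mathbb{I}_{\{\tau_j<\tau_i\}}+\alpha^{\tau_i}h_i(X_{\tau_i})\mathbb{I}_{\{\tau_i=\tau_j<\infty\}}\big].$$ Equilibrium. $(p^{(1)},p^{(2)})$ is a global Markovian randomized equilibrium if for all $x\in E$: $J_1(x;\tau^{p^{(1)}},\tau^{p^{(2)}})=\sup_{\tau_1\in\mathcal{T}_1}J_1(x;\tau_1,\tau^{p^{(2)}})$ and $J_2(x;\tau^{p^{(1)}},\tau^{p^{(2)}})=\sup_{\tau_2\in\mathcal{T}_2}J_2(x;\tau^{p^{(1)}},\tau_2)$. *)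

(* Defs.v *)
From HB Require Import structures.
From mathcomp Require Import all_boot all_order all_algebra finmap.
From mathcomp Require Import all_classical all_reals all_analysis.

Set Implicit Arguments.
Unset Strict Implicit.
Unset Printing Implicit Defensive.

Import Order.TTheory GRing.Theory Num.Theory.

Local Open Scope classical_set_scope.
Local Open Scope ring_scope.

(* Values of stopping times: [Some n] is the time n, [None] is infinity. *)
Definition time := option nat.

Definition time_le_nat (s : time) (n : nat) : bool :=
  if s is Some m then (m <= n)%N else false.

Definition time_lt (s t : time) : bool :=
  match s, t with
  | Some m, Some n => (m < n)%N
  | Some _, None => true
  | None, _ => false
  end.

(* The two players; the opponent of [i] is [~~ i]. *)
Definition player := bool.

(* The sources of randomness: the chain X as a whole, the killing time T, and
   the individual variables xi^(i)_n. *)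
Inductive source :=
  | chain
  | killing_time
  | randomizer of player & nat.

HB.instance Definition _ := gen_eqMixin source.
HB.instance Definition _ := gen_choiceMixin source.

Definition mutually_independent {d} {W : measurableType d} {R : realType}
    (P : probability W R) (I : choiceType) (F : I -> set (set W)) : Prop :=
  forall (J : {fset I}) (A : I -> set W),
    (forall i, i \in J -> F i (A i)) ->
    P (\bigcap_(i in [set` J]) A i) = (\prod_(i <- J) P (A i))%E.

Section game.
Context {R : realType} {dE dW : measure_display}
  {E : measurableType dE} {W : measurableType dW}.

Implicit Types (P : E -> probability W R) (X : nat -> {mfun W >-> E})
  (xi : player -> nat -> {mfun W >-> R}) (T : {mfun W >-> nat})
  (F : E -> R) (tau : W -> time).

Definition chain_history X (n : nat) : set (set W) :=
  <<s \bigcup_(k in `I_n.+1) g_sigma_algebra_preimage (X k) >>.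

(* [P x (A `&` {X_(n+1) in B}) = \int_A Pi(X_n, B) dP_x] for all A in
   sigma(X_0, .., X_n) says that Pi(X_n, B) is a version of the conditional
   probability of {X_(n+1) in B} given sigma(X_0, .., X_n) under P_x. *)
Definition markov_process P X (Pi : R.-pker E ~> E) : Prop :=
  forall x,
    {ae P x, forall w, X 0%N w = x} /\
    forall n (A : set W) (B : set E), chain_history X n A -> measurable B ->
      P x (A `&` X n.+1 @^-1` B) = (\int[P x]_(w in A) Pi (X n w) B)%E.

Definition source_events X xi T (s : source) : set (set W) :=
  match s with
  | chain => <<s \bigcup_k g_sigma_algebra_preimage (X k) >>
  | killing_time => g_sigma_algebra_preimage T
  | randomizer i n => g_sigma_algebra_preimage (xi i n)
  end.

Definition independent_sources P X xi T : Prop :=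
  forall x, mutually_independent (P x) (source_events X xi T).

Definition uniform_randomizers P xi : Prop :=
  forall x i n (B : set R), measurable B ->
    distribution (P x) (xi i n) B = uniform_prob (@ltr01 R) B.

Definition geometric_killing P (alpha : R) T : Prop :=
  forall x k, P x (T @^-1` [set k]) = ((1 - alpha) * alpha ^+ k)%:E.

(* The killed process lives in [option E], the cemetery K being [None]. *)
Definition killed X T (n : nat) (w : W) : option E :=
  if (n <= T w)%N then Some (X n w) else None.

Definition extend_to_cemetery F (y : option E) : R := oapp F 0 y.

Definition sup_killed_integrable P X T F : Prop :=
  forall x, (P x).-integrable setT (fun w =>
    ereal_sup [set `|extend_to_cemetery F (killed X T n w)|%:E | n in setT]).

Definition player_history X xi (i : player) (n : nat) : set (set W) :=
  <<s \bigcup_(k in `I_n.+1)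
        (g_sigma_algebra_preimage (X k)
           `|` g_sigma_algebra_preimage (xi i k)) >>.

Definition stopping_times X xi (i : player) : set (W -> time) :=
  [set tau | forall n,
     player_history X xi i n [set w | time_le_nat (tau w) n]].

Definition first_time (A : pred nat) : time :=
  if pselect (exists n, A n) is left exA then Some (ex_minn exA) else None.

Definition randomized_time X xi (i : player) (p : E -> R) (w : W) : time :=
  first_time [pred n | xi i n w <= p (X n w)].

(* alpha^tau F(X_tau); the value 0 at tau = infinity is immaterial, since the
   rewards only use this on events where tau is finite. *)
Definition discounted X (alpha : R) F tau (w : W) : R :=
  if tau w is Some n then alpha ^+ n * F (X n w) else 0.

Definition payoff X (alpha : R) (f g h : E -> R) (own other : W -> time)
    (w : W) : R :=
  discounted X alpha f own w * (time_lt (own w) (other w))%:R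
  + discounted X alpha g other w * (time_lt (other w) (own w))%:R
  + discounted X alpha h own w * ((own w == other w) && (own w != None))%:R.

(* J_i(x; tau_1, tau_2) with [own] = tau_i and [other] = tau_j, j <> i. *)
Definition reward P X (alpha : R) (f g h : player -> {mfun E >-> R})
    (i : player) (x : E) (own other : W -> time) : \bar R :=
  ('E_(P x)[payoff X alpha (f i) (g i) (h i) own other])%E.

Definition markov_strategy (p : E -> R) : Prop :=
  measurable_fun setT p /\ forall x, 0 <= p x <= 1.

Definition global_markovian_randomized_equilibrium P X xi (alpha : R)
    (f g h : player -> {mfun E >-> R}) (p : player -> E -> R) : Prop :=
  (forall i, markov_strategy (p i)) /\
  forall x i,
    let opponent := randomized_time X xi (~~ i) (p (~~ i)) in
    reward P X alpha f g h i x (randomized_time X xi i (p i)) opponent =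
    ereal_sup [set reward P X alpha f g h i x tau opponent
              | tau in stopping_times X xi i].

End game.

(* Main.v *)
Require Import Defs.
From mathcomp Require Import all_boot all_order all_algebra perm finmap.
From mathcomp Require Import all_classical all_reals all_analysis.
From mathcomp Require Import measurable_realfun ring lra zify.

Set Implicit Arguments.
Unset Strict Implicit.
Unset Printing Implicit Defensive.

Import Order.TTheory GRing.Theory Num.Theory.
Import numFieldNormedType.Exports.
Local Open Scope classical_set_scope.
Local Open Scope ring_scope.

(** At a state [y], let the players stop with probabilities [p_1 y], [p_2 y],
and let [V_i y] be the resulting payoff of player [i] in the one-round game in
which a round without any stop is worth [alpha * \int[Pi y]_z V_i z].  If at
each state [(p_1 y, p_2 y)] is an equilibrium of this two-by-two game, then
[(p_1, p_2)] is an equilibrium of the whole game, with values [V_i].  Indeed,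
fix the opponent's [p_j] and let player [i] use any stopping time: the expected
payoff collected before time [n], plus [alpha ^+ n * V_i (X n)] on the event
that nobody has stopped yet, does not increase with [n], is constant if [i]
uses [p_i], starts at [V_i x] and converges to the expected payoff
([Phi_succ], [expected_payoff_le], [expected_payoff_eq]).  The step from [n] to
[n + 1] uses that the opponent's coin at time [n] is independent of everything
else ([integral_coin]), and that the chain stays Markov when the randomizers
are added to its history ([integral_transition]).

These arguments need a function [M] that dominates all rewards, satisfies
[alpha * \int[Pi y]_z M z <= M y], and for which [alpha ^+ n] times the mean of
[M (X n)] tends to 0.  With [m] the sum of the absolute values of the six reward
functions, the potential [M = \sum_k alpha ^+ k * Pi ^ k m] has these
properties once it is finite.  It is finite because [(1 - alpha) * M x] is the
mean of [m (X T)], [T] being the geometric killing time, and [X T] is a state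
visited by the killed process, so that [m (X T)] is bounded by integrable
suprema ([potential_finite]).

It remains to find [p] and [V] ([stage_equilibrium]).  The numbers [p_i y] in
[[0, 1]] and [V_i y] in [[- M y, M y]], rescaled, form a point [z] of a Hilbert
cube, and the equilibrium conditions say that some continuous real functions
[F_c] of [z], one for each coordinate [c], satisfy [0 <= F_c z] when [0 < z_c]
and [F_c z <= 0] when [z_c < 1].  Such a point always exists
([cube_complementarity]); in finite dimension this is a form of Brouwer's
theorem.  It is obtained by looking at the first [N] coordinates on a grid of
mesh [1 / N], and passing to the limit by Tychonoff's theorem.

On the grid, the required statement is Kuhn's cubical lemma ([kuhn_cube]): if
the label [L k] is 0 where the [k]-th coordinate is minimal and 1 where it is
maximal, then some small cube sees both values of each label.  It follows from
a count modulo 2.  Sum, over the small cubes and over the monotone edge paths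
[v_0, .., v_n] through their corners, the product of the differences
[L k v_(k+1) - L k v_k]: this is a cup product of coboundaries, hence itself
the coboundary of a product where one factor is not differenced.  So the sum
does not change when a label is replaced by another one with the same values on
the sides, and it is 1 for the labels [0 < v k]. *)

(** * Products of label differences modulo 2 *)

Section cup_product.
Context {V : Type}.
Implicit Types (l : nat -> V -> 'F_2) (v w : nat -> V).

Lemma addrr_F2 (x : 'F_2) : x + x = 0.
Proof. exact/addrr_pchar2/pchar_Fp. Qed.

(** The cup product of the coboundaries of [l 0], .., [l n.-1], on the simplex
with vertices [v 0], .., [v n]. *)
Definition cup n l v := \prod_(i < n) (l i (v i.+1) + l i (v i)).

(** The cup product with [l k] itself in place of its coboundary, on the simplex
with vertices [w 0], .., [w n.-1]. *)
Fixpoint face_cup k n l w : 'F_2 :=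
  if k is k'.+1 then
    (l 0 (w 1) + l 0 (w 0)) * face_cup k' n.-1 (l \o S) (w \o S)
  else l 0 (w 0) * cup n.-1 (l \o S) w.

Lemma cupS n l v :
  cup n.+1 l v = (l 0 (v 1) + l 0 (v 0)) * cup n (l \o S) (v \o S).
Proof. by rewrite /cup big_ord_recl. Qed.

Lemma bump_comp_succ v j : (v \o bump j.+1) \o S = (v \o S) \o bump j.
Proof. by apply/funext => i /=; rewrite bumpS. Qed.

(** A product of coboundaries is a cocycle: in the sum over the faces of a
simplex, those opposite to [v 0] and [v 1] add up, modulo 2, to the missing term
of the same sum for one label less. *)
Lemma cup_coboundary n l v : \sum_(j < n.+2) cup n l (v \o bump j) = 0.
Proof.
elim: n l v => [|n IHn] l v.
  by rewrite big_ord_recl big_ord1 /cup !big_ord0 addrr_F2.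
rewrite 2!big_ord_recl !cupS /=.
have e (j : 'I_n.+1) : cup n.+1 l (v \o bump (bump 0 (bump 0 j))) =
  (l 0 (v 1) + l 0 (v 0)) * cup n (l \o S) ((v \o S) \o bump (bump 0 j)).
  by rewrite cupS (bump_comp_succ v (bump 0 j)).
under eq_bigr do rewrite e.
rewrite -mulr_sumr.
have := IHn (l \o S) (v \o S); rewrite big_ord_recl.
set A := cup _ _ _; set B := \sum_(i < _) _ => AB.
have -> : B = A by rewrite -[RHS]add0r -AB addrAC addrr_F2 add0r.
rewrite addrA -!mulrDl (_ : _ + _ = 0) ?mul0r//.
rewrite -[RHS](addrr_F2 (l 0 (v 0) + l 0 (v 1) + l 0 (v 2))) /bump /=; ring.
Qed.

(** Stokes' formula: since coboundaries are cocycles, taking the coboundary of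
[face_cup k] differences its only undifferenced factor.  The faces of the
simplex [v] are the sequences [v \o bump j]. *)
Lemma face_cup_coboundary k n l v : (k < n)%N ->
  \sum_(j < n.+1) face_cup k n l (v \o bump j) = cup n l v.
Proof.
elim: k n l v => [|k IHk] [//|n] l v kn; rewrite cupS.
  rewrite big_ord_recl /=.
  have e (j : 'I_n.+1) : l 0 (v (bump (bump 0 j) 0)) *
      cup n (l \o S) (v \o bump (bump 0 j)) =
    l 0 (v 0) * cup n (l \o S) (v \o bump (bump 0 j)) by [].
  under eq_bigr do rewrite e.
  have := cup_coboundary n (l \o S) v; rewrite big_ord_recl.
  set A := cup n _ _; set B := \sum_(i < _) _ => AB.
  have BA : B = A by rewrite -[RHS]add0r -AB addrAC addrr_F2 add0r.
  by rewrite -mulr_sumr -/B BA mulrDl.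
case: n kn => // n kn.
pose C j := face_cup k n.+1 (l \o S) ((v \o S) \o bump j).
have IH : \sum_(j < n.+2) C j = _ := IHk n.+1 (l \o S) (v \o S) kn.
rewrite -IH mulr_sumr 2!big_ord_recl [RHS]big_ord_recl addrA; congr (_ + _).
  rewrite /= -/(C 0).
  rewrite -mulrDl; congr (_ * _).
  rewrite -[RHS]addr0 -(addrr_F2 (l 0 (v 2))) /bump /=; ring.
apply: eq_bigr => j _ /=.
by rewrite (bump_comp_succ v (bump 0 j)).
Qed.

Lemma eq_cup n l l' v : (forall i (x : V), (i < n)%N -> l i x = l' i x) ->
  cup n l v = cup n l' v.
Proof. by move=> ll'; apply: eq_bigr => i _; rewrite !ll'. Qed.

Lemma cup_eq0 n l v i : (i < n)%N -> l i (v i.+1) = l i (v i) ->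
  cup n l v = 0.
Proof.
move=> lin e; rewrite /cup (bigD1 (Ordinal lin)) //= e.
by rewrite addrr_F2 mul0r.
Qed.

Lemma eq_face_cup k n l w w' : (k < n)%N ->
  (forall j, (j < n)%N -> w j = w' j) ->
  face_cup k n l w = face_cup k n l w'.
Proof.
elim: k n l w w' => [|k IHk] [//|n] l w w' kn ww' /=.
  rewrite ww'//; congr (_ * _); apply: eq_bigr => i _.
  by rewrite !ww'//; have := ltn_ord i; lia.
by rewrite !ww' //; [congr (_ * _); apply: IHk => // j jn /=; rewrite ww'|lia].
Qed.

Lemma face_cup_eq0 k n l w i : (k < n)%N -> (i < n)%N -> i != k ->
  (forall a b, (a < n)%N -> (b < n)%N -> l i (w a) = l i (w b)) ->
  face_cup k n l w = 0.
Proof.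
elim: k n l w i => [|k IHk] [//|n] l w i kn lin ik const /=.
  case: i lin ik const => // i lin _ const.
  rewrite (@cup_eq0 _ _ _ i) ?mulr0//=; apply: const; lia.
case: i lin ik const => [|i] lin ik const.
  by rewrite (const 1 0)%N ?addrr_F2 ?mul0r//; lia.
rewrite (IHk _ _ _ i) ?mulr0// => a b an bn.
by apply: const.
Qed.

Lemma face_cup_eq0_self k n l w : l k (w k) = 0 -> face_cup k n l w = 0.
Proof.
elim: k n l w => [|k IHk] n l w e /=; first by rewrite e mul0r.
by rewrite IHk ?mulr0.
Qed.

Lemma cup_replace n k l m l' v : (k < n)%N ->
  (forall i, i != k -> l i = l' i) -> (forall i, i != k -> m i = l' i) ->
  (forall x : V, l' k x = l k x + m k x) ->
  cup n l' v = cup n l v + cup n m v.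
Proof.
move=> kn ll' ml' lm.
rewrite /cup [LHS](bigD1 (Ordinal kn)) //= [X in _ = X + _](bigD1 (Ordinal kn)) //=.
rewrite [X in _ = _ + X](bigD1 (Ordinal kn)) //=.
rewrite !lm [X in _ = _ * X + _](eq_bigr (fun i : 'I_n =>
  l' i (v i.+1) + l' i (v i))); last first.
  by move=> i ik; rewrite ll'.
rewrite [X in _ = _ + _ * X](eq_bigr (fun i : 'I_n =>
  l' i (v i.+1) + l' i (v i))); last first.
  by move=> i ik; rewrite ml'.
by rewrite -mulrDl; congr (_ * _); ring.
Qed.

End cup_product.

(** * Kuhn's cubical lemma *)

Section kuhn.
Variables (n' p' : nat).
Let n := n'.+1.
Let p := p'.+1.
Let vertex := 'I_n -> nat.
Implicit Types (l : nat -> vertex -> 'F_2) (q : {ffun 'I_n -> 'I_p}) (s : 'S_n).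

(** The edge path from the lowest to the highest corner of the cube at [q] that
moves in direction [s^-1 m] at step [m]; as [s] varies, these paths list the
simplices of the Freudenthal triangulation of that cube. *)
Definition staircase q s (m : nat) : vertex := fun i => (q i + (s i < m)%N)%N.

Definition cube_sum l := \sum_q \sum_s cup n l (staircase q s).

(** The labels of Kuhn's lemma have [c = 1], the difference of two such labels
has [c = 0]. *)
Definition side_constant l (k : 'I_n) c :=
  [/\ forall v : vertex, v k = 0%N -> l k v = 0
    & forall v : vertex, v k = p -> l k v = c].

Lemma sum_pairs_F2 (F : 'S_n -> 'F_2) (t : 'S_n) : odd_perm t ->
  (forall s, F (s * t)%g = F s) -> \sum_s F s = 0.
Proof.
move=> oddt Ft; rewrite (bigID (@odd_perm _)) /=.
rewrite [X in _ + X](reindex_inj (mulIg t)) /=.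
rewrite [X in _ + X](eq_big (@odd_perm _) F).
- exact: addrr_F2.
- by move=> s; rewrite odd_permM oddt addbT negbK.
- by move=> s _; rewrite Ft.
Qed.

(** Two paths that differ by exchanging the steps [j.-1] and [j] have the same
face opposite to their [j]-th vertex, so these faces cancel in pairs. *)
Lemma sum_inner_face l (k : 'I_n) q (j : nat) : (0 < j < n)%N ->
  \sum_s face_cup k n l (staircase q s \o bump j) = 0.
Proof.
case: j => // j /andP[_ jn].
have jn' : (j < n)%N by exact: ltnW.
apply: (@sum_pairs_F2 _ (tperm (Ordinal jn) (Ordinal jn'))).
  by rewrite odd_tperm -val_eqE /=; apply/eqP; lia.
move=> s; congr face_cup; apply/funext => m; apply/funext => i /=.
congr addn; congr nat_of_bool; rewrite permM.
case: tpermP => [->|->|//] /=; rewrite /bump; case: leqP => /=; lia.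
Qed.

(** Deleting the first vertex of a path leaves the path that starts one step
later in the adjacent cube, with its last vertex deleted.  [ordS] is cyclic: a
path leaving the grid is sent to the opposite side. *)
Definition rotate (u : {ffun 'I_n -> 'I_p} * 'S_n) :
    {ffun 'I_n -> 'I_p} * 'S_n :=
  ([ffun i => if u.2 i == ord0 then ordS (u.1 i) else u.1 i],
   (u.2 * perm (@ord_pred_inj n))%g).

Lemma rotate_inj : injective rotate.
Proof.
move=> [q s] [q' s'] [] /ffunP qq' /mulIg ss'; subst s'; congr (_, _).
apply/ffunP => i; have := qq' i; rewrite !ffunE /=.
by case: ifP => // _ /ordS_inj.
Qed.

(** On a face contained in a side of the grid, either the undifferenced factor
vanishes or a differenced label is constant. *)
Lemma face_cup_side l (k : 'I_n) (i : 'I_n) c (w : nat -> vertex) :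
  (forall i : 'I_n, side_constant l i (i != k)%:R) ->
  (forall m, (m < n)%N -> w m i = c) -> c = 0%N \/ c = p ->
  face_cup k n l w = 0.
Proof.
move=> side wc c0p; have [ik|ik] := eqVneq i k.
  rewrite -ik; apply: face_cup_eq0_self; have [s0 sp] := side i.
  by case: c0p => c0; [rewrite s0|rewrite sp]; rewrite ?wc ?c0 ?ik ?eqxx ?ltn_ord.
apply: (@face_cup_eq0 _ _ _ _ _ i) => // a b an bn.
by have [s0 sp] := side i; case: c0p => c0; [rewrite !s0//|rewrite !sp//];
  rewrite wc ?ltn_ord.
Qed.

(** When [rotate] wraps around the grid, both faces lie in a side and both
products vanish. *)
Lemma rotate_face l (k : 'I_n) (u : {ffun 'I_n -> 'I_p} * 'S_n) :
  (forall i : 'I_n, side_constant l i (i != k)%:R) ->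
  face_cup k n l (staircase (rotate u).1 (rotate u).2 \o bump n) =
  face_cup k n l (staircase u.1 u.2 \o bump 0).
Proof.
move=> side; case: u => q s; pose i := (s^-1)%g ord0.
have si : s i = ord0 by rewrite permKV.
have [qi|qi] := eqVneq (q i).+1 p.
  rewrite (@face_cup_side l k i 0)//; last by left.
    rewrite (@face_cup_side l k i p)//; last by right.
    by move=> m mn /=; rewrite /staircase si /bump /=; lia.
  move=> m mn /=; rewrite /staircase /rotate /= ffunE permM permE si eqxx /=.
  rewrite qi modnn add0n /bump modn_small//; lia.
apply: eq_face_cup => // m mn; apply/funext => a /=.
rewrite /staircase /rotate /= ffunE permM permE /bump /= (leqNgt n m) mn /=.
case: eqVneq => [sa|sa].
  have <- : i = a by rewrite /i -sa permK.
  rewrite si /= modn_small; last by have := ltn_ord (q i); lia.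
  by rewrite modn_small//; lia.
have sa0 : (0 < s a)%N by rewrite lt0n.
congr addn; congr nat_of_bool.
have -> : ((s a + n).-1 %% n)%N = (s a).-1.
  by rewrite -(prednK sa0) addSn /= modnDr modn_small//; have := ltn_ord (s a); lia.
lia.
Qed.

(** By Stokes' formula the sum is taken over all faces: inner ones cancel in
pairs, and [rotate] matches the first ones with the last ones. *)
Lemma cube_sum_eq0 l (k : 'I_n) :
  (forall i : 'I_n, side_constant l i (i != k)%:R) -> cube_sum l = 0.
Proof.
move=> side; rewrite /cube_sum.
under eq_bigr do under eq_bigr do rewrite -(@face_cup_coboundary _ k)//.
under eq_bigr do rewrite exchange_big /=.
rewrite exchange_big big_ord_recl big_ord_recr /= [X in _ + (X + _)]big1.
  rewrite add0r !pair_bigA /=.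
  under eq_bigr do rewrite -(rotate_face _ side).
  rewrite -(reindex_inj rotate_inj (P := predT) (F := fun u =>
    face_cup k n l (staircase u.1 u.2 \o bump n))).
  exact: addrr_F2.
move=> j _; rewrite big1// => q _; apply: sum_inner_face => //=.
by rewrite /bump add1n ltnS ltn_ord.
Qed.

(** Products are additive in each label, and the difference of [l k] and [l' k]
vanishes on the sides. *)
Lemma cube_sum_replace l l' (k : 'I_n) :
  (forall i : 'I_n, side_constant l i 1) ->
  (forall i : 'I_n, side_constant l' i 1) ->
  (forall i : nat, i != k -> l i = l' i) -> cube_sum l = cube_sum l'.
Proof.
move=> sl sl' ll'.
pose m i := if i == k :> nat then fun v => l i v + l' i v else l i.
rewrite -[LHS]addr0 -(@cube_sum_eq0 m k); last first.
  move=> i; have [a b] := sl i; have [c d] := sl' i.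
  have -> : (i == k) = (i == k :> nat) by [].
  split => v vi; rewrite /m; case: eqP => _.
  - by rewrite a // c// addr0.
  - by rewrite a.
  - by rewrite b // d// addrr_F2.
  - by rewrite b.
rewrite /cube_sum -big_split; apply: eq_bigr => q _.
rewrite -big_split; apply: eq_bigr => s _ /=.
rewrite (@cup_replace _ n k l m l')// /m => [i ik|w].
  by rewrite (negbTE ik) ll'.
by rewrite eqxx addrA addrr_F2 add0r.
Qed.

Definition positive_label (k : nat) (v : vertex) : 'F_2 := (0 < v (inord k))%N%:R.

Lemma positive_label_side (i : 'I_n) : side_constant positive_label i 1.
Proof. by split=> v vi; rewrite /positive_label inord_val vi. Qed.

(** The [k]-th difference is nonzero only if the path moves in direction [k] at
step [k], away from the side where the coordinate is 0: a single path of a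
single cube satisfies this for all [k]. *)
Lemma cube_sum_positive_label : cube_sum positive_label = 1.
Proof.
pose q0 : {ffun 'I_n -> 'I_p} := [ffun=> ord0].
have fac (q : {ffun 'I_n -> 'I_p}) s (k : 'I_n) :
    positive_label k (staircase q s k.+1) + positive_label k (staircase q s k) =
    ((q k == ord0) && (s k == k))%:R.
  rewrite /positive_label /staircase inord_val -val_eqE /=.
  have [->|q0'] := posnP (q k).
    rewrite !add0n !lt0b -[s k == k]val_eqE /= ltnS.
    by case: (ltngtP (s k) k) => _; rewrite ?addrr_F2 ?addr0.
  by rewrite !addn_gt0 q0' addrr_F2 /= ?gtn_eqF.
rewrite /cube_sum (bigD1 q0) //= (bigD1 (1%g : 'S_n)) //= !big1 ?addr0.
- rewrite /cup big1// => k _; rewrite fac ffunE perm1 !eqxx//.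
- move=> q qq; apply: big1 => s _.
  suff [k qk] : exists k, q k != ord0.
    by rewrite /cup (bigD1 k) //= fac (negbTE qk) mul0r.
  apply/existsP; rewrite -negb_forall; apply: contra qq => /forallP qq.
  by apply/eqP/ffunP => k; rewrite ffunE; exact/eqP.
- move=> s s1; suff [k sk] : exists k, s k != k.
    by rewrite /cup (bigD1 k) //= fac (negbTE sk) andbF mul0r.
  apply/existsP; rewrite -negb_forall; apply: contra s1 => /forallP s1.
  by apply/eqP/permP => k; rewrite perm1; exact/eqP.
Qed.

(** The labels are replaced by the positive ones, one at a time. *)
Lemma cube_sum_side_constant l : (forall i : 'I_n, side_constant l i 1) ->
  cube_sum l = 1.
Proof.
move=> sl; pose hyb m k := if (k < m)%N then positive_label k else l k.
have shyb m (i : 'I_n) : side_constant (hyb m) i 1.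
  have [? ?] := sl i; have [? ?] := positive_label_side i.
  by rewrite /hyb; split=> v vi; case: ifP => _; auto.
have step m : (m <= n)%N -> cube_sum l = cube_sum (hyb m).
  elim: m => [|m IHm] mn; first by [].
  rewrite IHm 1?ltnW//; apply: (@cube_sum_replace _ _ (Ordinal mn)) => // i /= im.
  by rewrite /hyb ltnS [in RHS]leq_eqVlt (negbTE im).
rewrite (step n)// -cube_sum_positive_label /cube_sum.
by do 2 apply: eq_bigr => ? _; apply: eq_cup => i w ni; rewrite /hyb ni.
Qed.

(** The sum is odd, so one of the products is nonzero; its path shows two
vertices with different labels for each [k]. *)
Lemma kuhn_cube (L : 'I_n -> vertex -> bool) :
  (forall i v, v i = 0%N -> ~~ L i v) -> (forall i v, v i = p -> L i v) ->
  exists q : vertex, (forall i, (q i < p)%N) /\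
    forall i, exists v w : vertex, [/\ forall j, (q j <= v j <= (q j).+1)%N,
      forall j, (q j <= w j <= (q j).+1)%N, ~~ L i v & L i w].
Proof.
move=> L0 Lp; pose l k v : 'F_2 := (L (inord k) v)%:R.
have : cube_sum l != 0.
  rewrite cube_sum_side_constant ?oner_eq0// => i; split=> v vi.
    by rewrite /l inord_val (negbTE (L0 _ _ vi)).
  by rewrite /l inord_val Lp.
have stair q s m j : (q j <= staircase q s m j <= (q j).+1)%N.
  by rewrite /staircase; case: (_ < _)%N; lia.
move=> tot; have [q hq] : exists q, \sum_s cup n l (staircase q s) != 0.
  apply/existsP; rewrite -negb_forall; apply: contra tot => /forallP h.
  by rewrite /cube_sum big1// => q _; exact/eqP.
have [s hs] : exists s, cup n l (staircase q s) != 0.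
  apply/existsP; rewrite -negb_forall; apply: contra hq => /forallP h.
  by rewrite /cube_sum big1// => s _; exact/eqP.
exists (fun i => q i); split => // i.
have : l i (staircase q s i.+1) != l i (staircase q s i).
  by apply: contra hs => /eqP e; rewrite (cup_eq0 _ e).
rewrite /l inord_val; case: (boolP (L i (staircase q s i.+1))) => h1;
  case: (boolP (L i (staircase q s i))) => h2 // _.
- by exists (staircase q s i), (staircase q s i.+1).
- by exists (staircase q s i.+1), (staircase q s i).
Qed.

End kuhn.

(** * Complementarity on the Hilbert cube *)

Section cube.
Context {R : realType} {I : choiceType}.
Implicit Types (z u r s : I -> R).

Definition in_cube z := forall i, 0 <= z i <= 1.

Section cluster.
Import ArrowAsProduct.

(** A cluster point exists by Tychonoff's theorem, and the neighbourhoods below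
form a countable basis at it. *)
Lemma cube_cluster (code : I -> nat) (u : nat -> I -> R) :
  injective code -> (forall n, in_cube (u n)) ->
  exists z, in_cube z /\ forall k, exists2 n, (k <= n)%N &
    forall i, (code i <= k)%N -> `|u n i - z i| < k.+1%:R^-1.
Proof.
move=> codeI u01.
have K := @tychonoff I (fun=> R) (fun=> `[0, 1]%classic) (fun=> @segment_compact R 0 1).
have [|z [z01 clz]] := K (u @ \oo) _.
  by exists 0%N => // n _ i /=; rewrite in_itv /=; exact: u01.
exists z; split => [i|k]; first by have := z01 i; rewrite /= in_itv.
have nz : nbhs z [set f | forall i, (code i <= k)%N -> `|f i - z i| < k.+1%:R^-1].
  have : \forall f \near nbhs z, forall m : 'I_k.+1, forall i, code i = m ->
    `|f i - z i| < k.+1%:R^-1.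
    apply: (@filter_forall _ 'I_k.+1 _ (nbhs z)) => m.
    have [[i im]|noi] := pselect (exists i, code i = m).
      have : proj i f @[f --> z] --> proj i z := @proj_continuous I (fun=> R) i z.
      move=> /cvgrPdist_lt /(_ k.+1%:R^-1); rewrite invr_gt0 ltr0n => /(_ isT).
      apply: filterS => f /= fz j jm.
      by have -> : j = i by [apply: codeI; rewrite im jm]; rewrite distrC.
    by apply: nearW => f i im; exfalso; apply: noi; exists i.
  apply: filterS => f /= h i ik.
  exact: (h (Ordinal (ik : (code i < k.+1)%N))).
have kn : (u @ \oo) (u @` [set n | (k <= n)%N]).
  by exists k => // m km; exists m.
have [_ [[n /= kn' <-]]] := clz _ _ kn nz.
by exists n.
Qed.

End cluster.

(** Sequences suffice for countable [I], the cube being then metrizable. *)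
Definition cube_continuous (F : (I -> R) -> R) :=
  forall (u : nat -> I -> R) z, (forall n, in_cube (u n)) -> in_cube z ->
    (forall i, u n i @[n --> \oo] --> z i) -> F (u n) @[n --> \oo] --> F z.

(** Kuhn's lemma on the grid of mesh [1 / N.+1] in the first [N.+1] coordinates,
the others being 0.  A vertex is labelled 1 where [F i] is negative, up to the
values that are forced on the sides; [r] and [s] are vertices of the same cube
with label 0 and 1. *)
Lemma approx_complementarity (code : I -> nat) (F : I -> (I -> R) -> R) (N : nat) :
  injective code ->
  exists z, in_cube z /\ forall i, (code i <= N)%N ->
    exists r s, [/\ in_cube r /\ in_cube s,
      forall j, `|r j - z j| <= N.+1%:R^-1,
      forall j, `|s j - z j| <= N.+1%:R^-1,
      0 < r i -> 0 <= F i r & s i < 1 -> F i s <= 0].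
Proof.
move=> codeI; pose p := N.+1.
pose point (v : 'I_N.+1 -> nat) (i : I) : R :=
  if (code i <= N)%N then (minn (v (inord (code i))) p)%:R / p%:R else 0.
pose L (k : 'I_N.+1) (v : 'I_N.+1 -> nat) : bool :=
  (p <= v k)%N || ((0 < v k)%N && `[< exists2 i, code i = k & F i (point v) < 0 >]).
have pp : (0 : R) < p%:R by rewrite ltr0n.
have point01 v : in_cube (point v).
  move=> i; rewrite /point; case: ifP => _; last by rewrite lexx ler01.
  by rewrite divr_ge0 ?ler0n//= ler_pdivrMr// mul1r ler_nat geq_minr.
have near v w : (forall j, w j <= v j <= (w j).+1)%N ->
    forall j, `|point v j - point w j| <= N.+1%:R^-1.
  move=> vw j; rewrite /point; case: ifP => _;
    last by rewrite subrr normr0 invr_ge0 ler0n.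
  rewrite -mulrBl normrM [X in _ * X]ger0_norm ?invr_ge0 ?ler0n//.
  rewrite ler_pdivrMr// mulVf ?gt_eqF// -natrB; last first.
    by have := vw (inord (code j)); lia.
  by rewrite normr_nat -[1]/(1%:R) ler_nat; have := vw (inord (code j)); lia.
have [||q [qp hq]] := @kuhn_cube N N L.
- by move=> k v vk; rewrite /L vk.
- by move=> k v vk; rewrite /L vk leqnn.
exists (point q); split => // i iN.
have [v [w [qv qw]]] := hq (inord (code i)).
rewrite /L negb_or -ltnNge => /andP[vp]; rewrite negb_and -leqNgt leqn0.
move=> v0F wF; exists (point v), (point w); split => //; try exact: near.
- rewrite {1}/point iN; case/orP: v0F => [/eqP ->|]; first by rewrite min0n mul0r ltxx.
  move=> /asboolPn noi _; rewrite leNgt; apply/negP => Fi; apply: noi.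
  by exists i => //; rewrite inordK.
- rewrite {1}/point iN; case/orP: wF => [pw|/andP[_ /asboolP[j]]].
    by rewrite (minn_idPr pw) divff ?gt_eqF// ltxx.
  by rewrite inordK // => /codeI -> /ltW.
Qed.

(** A form of Brouwer's theorem for infinitely many coordinates: [F] vanishes up
to components pointing out of the cube. *)
Theorem cube_complementarity (F : I -> (I -> R) -> R) :
  countable [set: I] -> (forall i, cube_continuous (F i)) ->
  exists z, in_cube z /\
    forall i, (0 < z i -> 0 <= F i z) /\ (z i < 1 -> F i z <= 0).
Proof.
move=> /countable_injP[code codeI] Fc.
have {}codeI : injective code by move=> i j; apply: codeI; rewrite inE.
have [u hu] := choice (fun N => @approx_complementarity code F N codeI).
have [z [z01 zu]] := @cube_cluster code u codeI (fun n => (hu n).1).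
exists z; split=> // i.
have [n hn] := choice (fun k => let: ex_intro2 n a b := zu k in
  ex_intro (fun n => _ /\ _) n (conj a b)).
(* The index is at least [code i], so that coordinate [i] is on the grid. *)
have [r hr] := choice (fun k => (hu (n (code i + k)%N)).2 i
   (leq_trans (leq_addr k (code i)) (hn (code i + k)%N).1)).
have [s hs] := choice hr.
pose e (k : nat) : R := k.+1%:R^-1.
have e0 : e k @[k --> \oo] --> 0 by exact: cvg_harmonic.
have lim (t : nat -> I -> R) :
    (forall k j, `|t k j - u (n (code i + k)%N) j| <=
      (n (code i + k)%N).+1%:R^-1) ->
    forall j, t k j @[k --> \oo] --> z j.
  move=> ht j; apply/cvgrPdistC_lt => d d0.
  have d20 : 0 < d / 2 by rewrite divr_gt0.
  move/cvgrPdist_lt : e0 => /(_ _ d20) ed.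
  near=> k.
  have kn := (hn (code i + k)%N).1.
  have -> : t k j - z j =
    (t k j - u (n (code i + k)%N) j) + (u (n (code i + k)%N) j - z j) by ring.
  rewrite (le_lt_trans (ler_normD _ _))// [d]splitr ltrD//.
    rewrite (le_lt_trans (ht k j))//.
    rewrite (@le_lt_trans _ _ (e k))//.
      by rewrite /e lef_pV2 ?posrE ?ltr0n// ler_nat; lia.
    by near: k; apply: filterS ed => k; rewrite sub0r normrN; apply: le_lt_trans;
      exact: ler_norm.
  apply: (@lt_trans _ _ (e (code i + k)%N)).
    apply: (hn (code i + k)%N).2.
    have : (code j <= k)%N by near: k; exact: nbhs_infty_ge.
    lia.
  rewrite (@le_lt_trans _ _ (e k))//.
    by rewrite /e lef_pV2 ?posrE ?ltr0n// ler_nat; lia.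
  by near: k; apply: filterS ed => k; rewrite sub0r normrN; apply: le_lt_trans;
    exact: ler_norm.
have rz := lim r (fun k => let: And5 _ a _ _ _ := hs k in a).
have sz := lim s (fun k => let: And5 _ _ a _ _ := hs k in a).
have Fr : F i (r k) @[k --> \oo] --> F i z.
  by apply: Fc => // k; have [[]] := hs k.
have Fs : F i (s k) @[k --> \oo] --> F i z.
  by apply: Fc => // k; have [[]] := hs k.
split => zi.
- apply: (cvgr_to_ge Fr); apply: filterS (cvgr_gt _ (rz i) _ zi) => k.
  by case: (hs k).
- apply: (cvgr_to_le Fs); apply: filterS (cvgr_lt _ (sz i) _ zi) => k.
  by case: (hs k).
Unshelve. all: by end_near. Qed.
End cube.

(** * Dominated real integrals *)

Section dominated.
Context d (T : measurableType d) (R : realType).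
Variable mu : {measure set T -> \bar R}.

Lemma le_Rintegrable (f g : T -> R) : measurable_fun setT f ->
  (forall x, `|f x| <= g x) -> mu.-integrable setT (EFin \o g) ->
  mu.-integrable setT (EFin \o f).
Proof.
move=> mf fg; apply: le_integrable => //; first exact/measurable_EFinP.
by move=> x _ /=; rewrite lee_fin (le_trans (fg x))// ler_norm.
Qed.

Lemma dominated_cvg_Rintegral (f_ : nat -> T -> R) (f g : T -> R) :
  (forall n, measurable_fun setT (f_ n)) -> measurable_fun setT f ->
  mu.-integrable setT (EFin \o g) -> (forall n x, `|f_ n x| <= g x) ->
  (forall x, f_ n x @[n --> \oo] --> f x) ->
  (\int[mu]_x f_ n x)%R @[n --> \oo] --> (\int[mu]_x f x)%R.
Proof.
move=> mf_ mf ig fg ff.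
have iff : mu.-integrable setT (EFin \o f).
  apply: le_Rintegrable ig => // x.
  apply: (cvgr_to_le (cvg_norm (ff x))); exact: nearW.
rewrite /Rintegral; apply: fine_cvg.
rewrite fineK; last exact: integrable_fin_num.
apply: (@dominated_cvg _ _ _ mu setT measurableT
  (fun n => EFin \o f_ n) (EFin \o f) (EFin \o g)) => //.
- by move=> n; exact/measurable_EFinP.
- move=> x _; apply/cvg_EFin => /=; [exact: nearW|exact: ff].
- by move=> n x _ /=; rewrite lee_fin.
Qed.
End dominated.

(** * Equilibria of the stage games *)

Section stage_game.
Context {R : realType} {dE : measure_display} {E : measurableType dE}.
Variables (discreteE : forall A : set E, measurable A) (Pi : R.-pker E ~> E).
Variables (alpha : R) (alpha0 : 0 <= alpha).
Variable M : E -> R.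
Hypothesis iM : forall y, (Pi y).-integrable setT (EFin \o M).
Hypothesis sM : forall y, alpha * (\int[Pi y]_z M z)%R <= M y.

Lemma measurable_discrete dT (T : measurableType dT) (D : set E) (phi : E -> T) :
  measurable_fun D phi.
Proof. by move=> _ B _; exact: discreteE. Qed.

Definition continuation (V : E -> R) (y : E) : R := alpha * (\int[Pi y]_z V z)%R.

(** [stop_value] and [continue_value] are the payoffs at state [y] of the two
actions of a player whose opponent stops with probability [q], [V] being the
value of the game for that player. *)
Definition stop_value (f h : E -> R) (q : R) (y : E) :=
  (1 - q) * f y + q * h y.
Definition continue_value (g V : E -> R) (q : R) (y : E) :=
  q * g y + (1 - q) * continuation V y.

Lemma norm_continuation V y : (forall z, `|V z| <= M z) ->
  `|continuation V y| <= M y.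
Proof.
move=> VM; apply: le_trans (sM y); rewrite normrM ger0_norm//.
have mV := @measurable_discrete _ R setT V.
have iV : (Pi y).-integrable setT (EFin \o V) by apply: le_Rintegrable (iM y).
apply: ler_wpM2l => //; apply: le_trans (le_normr_Rintegral _ _) _ => //.
apply: le_Rintegral => //.
apply: le_Rintegrable (iM y); first exact: measurable_discrete.
by move=> z; rewrite normr_id.
Qed.

Lemma norm_mix (q a b m : R) : 0 <= q <= 1 -> `|a| <= m -> `|b| <= m ->
  `|(1 - q) * a + q * b| <= m.
Proof.
move=> /andP[q0 q1] am bm; rewrite (le_trans (ler_normD _ _))//.
rewrite !normrM (ger0_norm q0) (@ger0_norm _ (1 - q)) ?subr_ge0//.
nra.
Qed.

Section equilibrium.
Variables (f g h : player -> E -> R).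
Hypothesis countableE : countable [set: E].
Hypothesis fM : forall i y, `|f i y| <= M y.
Hypothesis gM : forall i y, `|g i y| <= M y.
Hypothesis hM : forall i y, `|h i y| <= M y.

(** Coordinate [(i, true, y)] is the probability that [i] stops at [y], and
coordinate [(i, false, y)] is the position of [V i y] in [[- M y, M y]]. *)
Let I : Type := (player * bool * E)%type.
Let strat (z : I -> R) (i : player) y := z (i, true, y).
Let val (z : I -> R) (i : player) y := M y * (2 * z (i, false, y) - 1).
Let stop z i y := stop_value (f i) (h i) (strat z (~~ i) y) y.
Let cont z i y := continue_value (g i) (val z i) (strat z (~~ i) y) y.
Let gain (c : I) (z : I -> R) : R :=
  let: (i, b, y) := c in
  if b then stop z i y - cont z i y
  else (1 - strat z i y) * cont z i y + strat z i y * stop z i y - val z i y.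

Let M0 y : 0 <= M y. Proof. exact: le_trans (fM true y). Qed.

Let valM z i y : in_cube z -> `|val z i y| <= M y.
Proof.
move=> z01; rewrite /val normrM ger0_norm//.
have /andP[a b] := z01 (i, false, y).
rewrite ler_piMr// ler_norml; lra.
Qed.

Let gain_continuous c : cube_continuous (gain c).
Proof.
move=> u z u01 z01 uz.
have cstrat i y : strat (u n) i y @[n --> \oo] --> strat z i y by exact: uz.
have cval i y : val (u n) i y @[n --> \oo] --> val z i y.
  by apply: cvgMr; apply: cvgB; [apply: cvgMr; exact: uz|exact: cvg_cst].
have cstop i y : stop (u n) i y @[n --> \oo] --> stop z i y.
  apply: cvgD; apply: cvgMl => //; apply: cvgB => //; exact: cvg_cst.
have ccont i y : cont (u n) i y @[n --> \oo] --> cont z i y.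
  apply: cvgD; first by apply: cvgMl.
  apply: cvgM; first by apply: cvgB => //; exact: cvg_cst.
  apply: cvgMr; apply: (@dominated_cvg_Rintegral _ _ _ _ _ _ M) => //.
  - by move=> n; exact: measurable_discrete.
  - by move=> n x; exact: valM.
case: c => [[i []] y] /=.
  exact: cvgB.
apply: cvgB => //; apply: cvgD; apply: cvgM => //.
apply: cvgB => //; exact: cvg_cst.
Qed.

(** Complementarity at [(i, true, y)] says that [p i y] is a best reply, and at
[(i, false, y)] that [V i y] is the payoff of the stage game; there the ends of
the interval are harmless because that payoff is itself bounded by [M y]. *)
Lemma stage_equilibrium : exists (p V : player -> E -> R),
  forall i y, let q := p (~~ i) y in
    [/\ 0 <= p i y <= 1, `|V i y| <= M y,
        stop_value (f i) (h i) q y <= V i y,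
        continue_value (g i) (V i) q y <= V i y &
        V i y = p i y * stop_value (f i) (h i) q y
                + (1 - p i y) * continue_value (g i) (V i) q y].
Proof.
have cI : countable [set: I].
  rewrite -setXTT.
  by apply: countableX => //; exact: countableP.
have [z [z01 hz]] := cube_complementarity cI gain_continuous.
exists (strat z), (val z) => i y /=.
have /andP[p0 p1] := z01 (i, true, y).
have [sM' cM'] : `|stop z i y| <= M y /\ `|cont z i y| <= M y.
  split; first by apply: norm_mix; [exact: z01|exact: fM|exact: hM].
  rewrite /cont /continue_value addrC; apply: norm_mix; [exact: z01| |exact: gM].
  by apply: norm_continuation => x; exact: valM.
have [/= hv0 hv1] := hz (i, false, y).
have [/= hp0 hp1] := hz (i, true, y).
have mixM := @norm_mix (strat z i y) _ _ _ (z01 _) cM' sM'.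
have eqV : val z i y = strat z i y * stop z i y + (1 - strat z i y) * cont z i y.
  have /andP[v0 v1] := z01 (i, false, y).
  move: mixM; rewrite ler_norml => /andP[ml mu].
  apply/eqP; rewrite eq_le; apply/andP; split.
    have [v00|/hv0] := leP (z (i, false, y)) 0; last by lra.
    have e : z (i, false, y) = 0 by apply/eqP; rewrite eq_le v00.
    by move: ml; rewrite /val e; lra.
  have [v11|/hv1] := leP 1 (z (i, false, y)); last by lra.
  have e : z (i, false, y) = 1 by apply/eqP; rewrite eq_le v11 v1.
  by move: mu; rewrite /val e; lra.
split => //.
- by rewrite p0.
- exact: valM.
- rewrite -/(stop z i y) eqV.
  have [e|/hp1] := leP 1 (strat z i y).
    have -> : strat z i y = 1 by apply/eqP; rewrite eq_le e p1.
    by lra.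
  move: p0 p1; rewrite -/(strat z i y) => p0 p1 h1; nra.
- rewrite -/(cont z i y) eqV.
  have [e|/hp0] := leP (strat z i y) 0.
    have -> : strat z i y = 0 by apply/eqP; rewrite eq_le e p0.
    by lra.
  move: p0 p1; rewrite -/(strat z i y) => p0 p1 h1; nra.
Qed.
End equilibrium.
End stage_game.

(** * Independence, and integrals over a countable state space *)

Section independence.
Context {d} {W : measurableType d} {R : realType} (P : probability W R).

Lemma finite_measure_unique (m1 m2 : {measure set W -> \bar R}) (G : set (set W)) :
  G `<=` measurable -> setI_closed G -> G setT ->
  (forall A, G A -> m1 A = m2 A) -> (m1 setT < +oo)%E ->
  forall A, <<s G >> A -> m1 A = m2 A.
Proof.
move=> mG GI GT m12 m1oo.
apply: (@g_sigma_algebra_measure_unique _ _ _ G mG (fun=> setT)) => //.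
by apply/seteqP; split => // w _; exists 0%N.
Qed.

(** The form in which uniqueness of measures is applied: both sides are finite
measures in [A]. *)
Lemma prob_scale_g_sigma_algebra (G : set (set W)) (B C : set W) (c : R) :
  0 <= c -> G `<=` measurable -> setI_closed G -> G setT ->
  measurable B -> measurable C ->
  (forall A, G A -> P (A `&` B) = (c%:E * P (A `&` C))%E) ->
  forall A, <<s G >> A -> P (A `&` B) = (c%:E * P (A `&` C))%E.
Proof.
move=> c0 mG GI GT mB mC h A GA.
pose m1 : {measure set W -> \bar R} := mrestr P mB.
pose m2 : {measure set W -> \bar R} := mscale (NngNum c0) (mrestr P mC).
have -> : P (A `&` B) = m1 A by [].
have -> : (c%:E * P (A `&` C))%E = m2 A by [].
apply: finite_measure_unique GA => //.
have -> : m1 setT = P (setT `&` B) by [].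
by rewrite setTI -ge0_fin_numE ?fin_num_measure.
Qed.

(** Finite intersections of events of the other families form a pi-system that
generates their sigma-algebra. *)
Lemma independent_of_rest (I : choiceType) (F : I -> set (set W)) (s : I) :
  (forall i, F i `<=` measurable) -> (forall i, setI_closed (F i)) ->
  (forall i, F i setT) ->
  mutually_independent P F ->
  forall A B, <<s \bigcup_(i in [set i | i != s]) F i >> A -> F s B ->
    P (A `&` B) = (P B * P A)%E.
Proof.
move=> mF FI FT ind A B GA FB.
pose G := [set A | exists (J : {fset I}) (a : I -> set W), [/\ s \notin J,
   forall i, F i (a i) & A = \bigcap_(i in [set` J]) a i]].
have fB : P B \is a fin_num by apply: fin_num_measure; exact: mF FB.
have -> : (P B * P A)%E = ((fine (P B))%:E * P (A `&` setT))%E by rewrite fineK ?setIT.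
have GI : setI_closed G.
  move=> _ _ [J [a [sJ Fa ->]]] [K [b [sK Fb ->]]].
  exists (J `|` K)%fset, (fun i =>
    (if i \in J then a i else setT) `&` (if i \in K then b i else setT)).
  split.
  - by rewrite in_fsetU negb_or sJ.
  - by move=> i; apply: FI; case: ifP.
  - apply/seteqP; split => w /=.
      by move=> [aw bw] i /= _; split; case: ifPn => // h; [exact: aw|exact: bw].
    move=> h; split => i /= ij.
      by have [|+ _] := h i; [rewrite /= in_fsetU ij|rewrite ij].
    by have [|_] := h i; [rewrite /= in_fsetU ij orbT|rewrite ij].
have mG : G `<=` measurable.
  move=> _ [J [a [_ Fa ->]]]; apply: fin_bigcap_measurable => // i _; exact: mF (Fa i).
have GT : G setT.
  exists fset0, (fun=> setT); split => //.
  by apply/seteqP; split => // w _ i.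
apply: (@prob_scale_g_sigma_algebra G) => //; first by rewrite fine_ge0.
- exact: mF FB.
- move=> _ [J [a [sJ Fa ->]]]; rewrite setIT fineK//.
  pose a' i := if i == s then B else a i.
  have e : \bigcap_(i in [set` J]) a i `&` B = \bigcap_(i in [set` (s |` J)%fset]) a' i.
    apply/seteqP; split => w /=.
      move=> [aw Bw] i /=; rewrite in_fset1U /a'; case: eqP => //= _; exact: aw.
    move=> h; split; last by have := h s; rewrite /= fset1U1 /a' eqxx; exact.
    move=> i /= iJ; have := h i; rewrite /= in_fset1U iJ orbT /a'.
    have /negbTE-> : i != s by apply: contraNneq sJ => <-.
    exact.
  rewrite e ind; last first.
    by move=> i _; rewrite /a'; case: eqP => // ->.
  rewrite big_fsetU1//= {1}/a' eqxx; congr (_ * _)%E.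
  rewrite [RHS]ind //; apply: eq_big_seq => i iJ; rewrite /a'.
  by have /negbTE-> : i != s by apply: contraNneq sJ => <-.
- apply: (smallest_sub _ _ GA); first exact: smallest_sigma_algebra.
  move=> C [i /= is_ FC]; apply: sub_sigma_algebra.
  exists [fset i]%fset, (fun j => if j == i then C else setT); split.
  + by rewrite inE eq_sym.
  + by move=> j; case: eqP => // ->.
  + apply/seteqP; split => w; first by move=> Cw j /=; rewrite inE => /eqP ->;
      rewrite eqxx.
    by move/(_ i); rewrite /= inE eqxx; exact.
Qed.

End independence.

Section fibers.
Context {R : realType} {dE : measure_display} {E : measurableType dE}.
Variables (discreteE : forall A : set E, measurable A).
Variables (countableE : countable [set: E]).

Section split.
Context {d1 d2} {T1 : measurableType d1} {T2 : measurableType d2}.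
Variables (m1 : {measure set T1 -> \bar R}) (m2 : {measure set T2 -> \bar R}).
Variables (Y1 : T1 -> E) (Y2 : T2 -> E).
Hypotheses (mY1 : measurable_fun setT Y1) (mY2 : measurable_fun setT Y2).

(** The fibers form countable partitions.  On each of them the integrands met
below are constant, which turns integrals into probabilities. *)
Lemma eq_integral_fibers (D1 : set T1) (D2 : set T2)
    (F1 : T1 -> \bar R) (F2 : T2 -> \bar R) :
  measurable D1 -> measurable D2 -> measurable_fun D1 F1 -> measurable_fun D2 F2 ->
  (forall x, (0 <= F1 x)%E) -> (forall x, (0 <= F2 x)%E) ->
  (forall y, \int[m1]_(x in D1 `&` Y1 @^-1` [set y]) F1 x =
    \int[m2]_(x in D2 `&` Y2 @^-1` [set y]) F2 x)%E ->
  (\int[m1]_(x in D1) F1 x = \int[m2]_(x in D2) F2 x)%E.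
Proof.
move=> mD1 mD2 mF1 mF2 F10 F20 e.
have [code codeI] := countable_injP _ countableE.
have {}codeI : injective code by move=> i j; apply: codeI; rewrite inE.
have split d (T : measurableType d) (m : {measure set T -> \bar R})
    (Y : T -> E) (D : set T) (F : T -> \bar R) :
    measurable_fun setT Y -> measurable D -> measurable_fun D F ->
    (forall x, 0 <= F x)%E ->
    (\int[m]_(x in D) F x =
     \sum_(k <oo) \int[m]_(x in D `&` (code \o Y) @^-1` [set k]) F x)%E.
  move=> mY mD mF F0.
  have eD : D = \bigcup_k (D `&` (code \o Y) @^-1` [set k]).
    by rewrite -setI_bigcupr; apply/seteqP; split => [x Dx|x []//]; split=> //;
      exists (code (Y x)).
  rewrite {1}eD ge0_integral_bigcup//.
  - move=> k; apply: measurableI => //; rewrite comp_preimage -[X in measurable X]setTI.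
    by apply: mY => //; exact: discreteE.
  - by rewrite -eD.
  - by apply: trivIset_setIl; apply: trivIset_preimage1.
rewrite (split _ _ m1 Y1)// (split _ _ m2 Y2)//; apply: eq_eseriesr => k _.
have [[y yk]|nok] := pselect (exists y, code y = k).
  have eq d (T : measurableType d) (Y : T -> E) :
      (code \o Y) @^-1` [set k] = Y @^-1` [set y].
    by apply/seteqP; split => x /=; [rewrite -yk => /codeI|move=> ->].
  by rewrite !eq.
have eq0 d (T : measurableType d) (Y : T -> E) : (code \o Y) @^-1` [set k] = set0.
  by rewrite -subset0 => x /= h; apply: nok; exists (Y x).
by rewrite !eq0 !setI0 !integral_set0.
Qed.
End split.

Lemma integral_fiber {d} {T : measurableType d} {m : {measure set T -> \bar R}}
    (Y : T -> E) (D : set T) (F : T -> \bar R) (y : E) (c : \bar R) :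
  measurable D -> measurable_fun setT Y -> (forall x, Y x = y -> F x = c) ->
  (\int[m]_(x in D `&` Y @^-1` [set y]) F x = c * m (D `&` Y @^-1` [set y]))%E.
Proof.
move=> mD mY Fc; rewrite -integral_cst; last first.
  by apply: measurableI => //; rewrite -[X in measurable X]setTI; exact: mY.
by apply: eq_integral => x; rewrite inE => -[_ /= /Fc].
Qed.

End fibers.

Lemma sigma_algebraI U (S : set (set U)) : sigma_algebra setT S -> setI_closed S.
Proof.
move=> [S0 Sc SU] A B SA SB.
rewrite -[A `&` B]setCK setCI -setTD; apply: (Sc).
rewrite -bigcup2E; apply: SU => -[|[|n]] //=; rewrite -setTD; exact: Sc.
Qed.

Lemma sigma_algebraT U (S : set (set U)) : sigma_algebra setT S -> S setT.
Proof. by case=> S0 Sc _; rewrite -[setT]setD0; exact: Sc. Qed.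

Lemma sigma_algebraD U (S : set (set U)) A B : sigma_algebra setT S ->
  S A -> S B -> S (A `\` B).
Proof.
move=> sS SA SB; rewrite setDE; apply: (sigma_algebraI sS) => //.
by case: sS => _ Sc _; rewrite -setTD; exact: Sc.
Qed.

(** * The chain and the randomizers *)

Section sources.
Context {R : realType} {dE dW : measure_display}
  {E : measurableType dE} {W : measurableType dW}.
Variables (discreteE : forall A : set E, measurable A).
Variables (countableE : countable [set: E]).
Variables (P : E -> probability W R) (X : nat -> {mfun W >-> E})
    (xi : player -> nat -> {mfun W >-> R}) (T : {mfun W >-> nat}).
Variable Pi : R.-pker E ~> E.
Hypotheses (markovX : markov_process P X Pi)
    (uniform_xi : uniform_randomizers P xi)
    (independent : independent_sources P X xi T).

Notation sources := (source_events X xi T).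

Lemma preimage_sub_measurable d (S : measurableType d) (Y : {mfun W >-> S}) :
  g_sigma_algebra_preimage Y `<=` measurable.
Proof. by move=> _ [B mB <-]; exact: measurable_funP. Qed.

Lemma source_events_sigma_algebra s : sigma_algebra setT (sources s).
Proof.
have sa d (S : measurableType d) (Y : W -> S) :
    sigma_algebra setT (g_sigma_algebra_preimage Y).
  exact/sigma_algebra_preimage/sigma_algebra_measurable.
case: s => [||i n] /=; [exact: smallest_sigma_algebra|exact: sa|exact: sa].
Qed.

Lemma source_events_measurable s : sources s `<=` measurable.
Proof.
case: s => [||i n] /=; try exact: preimage_sub_measurable.
apply: smallest_sub; first exact: sigma_algebra_measurable.
by move=> A [k _]; exact: preimage_sub_measurable.
Qed.

Lemma source_eventsI s : setI_closed (sources s).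
Proof. exact: (sigma_algebraI (source_events_sigma_algebra s)). Qed.

Lemma source_eventsT s : sources s setT.
Proof. exact: (sigma_algebraT (source_events_sigma_algebra s)). Qed.

Definition other_sources (s : source) : set (set W) :=
  <<s \bigcup_(s' in [set s' | s' != s]) sources s' >>.

Lemma other_sources_measurable s : other_sources s `<=` measurable.
Proof.
apply: smallest_sub; first exact: sigma_algebra_measurable.
by move=> A [s' _]; exact: source_events_measurable.
Qed.

Lemma source_independent x s A B : other_sources s A -> sources s B ->
  P x (A `&` B) = (P x B * P x A)%E.
Proof.
apply: (independent_of_rest (F := sources)).
- exact: source_events_measurable.
- exact: source_eventsI.
- exact: source_eventsT.
- exact: independent.
Qed.

Lemma sub_other_sources s s' : s' != s -> sources s' `<=` other_sources s.
Proof. by move=> ss' A SA; apply: sub_sigma_algebra; exists s'. Qed.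

Lemma state_event k B : sources chain (X k @^-1` B).
Proof.
apply: sub_sigma_algebra; exists k => //.
by exists B => //; rewrite setTI.
Qed.

Lemma measurable_state k B : measurable (X k @^-1` B).
Proof. by rewrite -[X in measurable X]setTI; exact: measurable_funP. Qed.

Lemma chain_history_sub n : chain_history X n `<=` sources chain.
Proof.
apply: sub_sigma_algebra2 => A [k _ XA]; by exists k.
Qed.

Lemma chain_history_measurable n : chain_history X n `<=` measurable.
Proof. by move=> A /chain_history_sub; exact: source_events_measurable. Qed.

Lemma chain_history_state n k B : (k <= n)%N -> chain_history X n (X k @^-1` B).
Proof.
move=> kn; apply: sub_sigma_algebra; exists k => //.
by exists B => //; rewrite setTI.
Qed.

Lemma chain_historyI n : setI_closed (chain_history X n).
Proof. by apply: sigma_algebraI; exact: smallest_sigma_algebra. Qed.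

Definition coin (i : player) n (q : E -> R) : set W :=
  [set w | xi i n w <= q (X n w)].

Lemma uniform_prob_le (u : R) : 0 <= u <= 1 ->
  uniform_prob (@ltr01 R) `]-oo, u]%classic = u%:E.
Proof.
move=> /andP[u0 u1]; rewrite /uniform_prob integral_uniform_pdf.
rewrite (_ : `]-oo, u] `&` `[0, 1] = `[0, u]%classic); last first.
  apply/seteqP; split => r /=; rewrite !in_itv /=; first by move=> [-> /andP[->]].
  by move=> /andP[-> ru]; rewrite ru (le_trans ru u1).
rewrite (eq_integral (cst 1%E)); last first.
  move=> r; rewrite inE /= in_itv /= => /andP[r0 ru].
  by rewrite /uniform_pdf r0 (le_trans ru u1)/= subr0 invr1.
rewrite integral_cst//= mul1e lebesgue_measure_itv /= lte_fin.
by case: ltgtP u0 => // [_ _|<- _]; rewrite ?sube0.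
Qed.

Lemma measurable_coin i n q : measurable (coin i n q).
Proof.
rewrite [coin i n q](_ : _ = setT `&` [set w | (xi i n w <= (q \o X n) w)]);
  last by rewrite setTI.
apply: measurable_fun_le => //.
apply: measurableT_comp => //; exact: measurable_discrete.
Qed.

(** The coin [xi i n] is uniform and independent of all other sources. *)
Lemma prob_coin x i n (u : R) A : 0 <= u <= 1 -> other_sources (randomizer i n) A ->
  P x (A `&` (xi i n @^-1` `]-oo, u])) = (u%:E * P x A)%E.
Proof.
move=> u01 SA; rewrite (source_independent _ SA); last first.
  by exists `]-oo, u]%classic => //; rewrite setTI.
have := uniform_xi x i n (measurable_itv `]-oo, u]).
by rewrite /distribution /= /pushforward uniform_prob_le// => ->.
Qed.

Lemma other_sourcesI s : setI_closed (other_sources s).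
Proof. by apply: sigma_algebraI; exact: smallest_sigma_algebra. Qed.

(** On the event that the current state is [y], the coin succeeds with
probability [q y] independently of [A]. *)
Lemma integral_coin x i n (q : E -> R) (phi : E -> R) A :
  (forall y, 0 <= q y <= 1) -> (forall y, 0 <= phi y) ->
  other_sources (randomizer i n) A ->
  (\int[P x]_(w in A `&` coin i n q) (phi (X n w))%:E
   = \int[P x]_(w in A) (q (X n w) * phi (X n w))%:E)%E.
Proof.
move=> q01 phi0 SA.
have mA := other_sources_measurable SA.
have mF D (psi : E -> R) : measurable_fun D (fun w => (psi (X n w))%:E).
  apply/measurable_EFinP/measurable_funTS/measurableT_comp => //;
    exact: measurable_discrete.
apply: (eq_integral_fibers discreteE countableE (Y1 := X n) (Y2 := X n)) => //.
- by apply: measurableI => //; exact: measurable_coin.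
- exact: (mF _ (fun y => q y * phi y)).
- by move=> w; rewrite lee_fin.
- by move=> w; rewrite lee_fin mulr_ge0//; case/andP: (q01 (X n w)).
move=> y.
rewrite (integral_fiber discreteE (c := (phi y)%:E))//; last by move=> w ->.
  rewrite (integral_fiber discreteE (c := (q y * phi y)%:E))//; last by move=> w ->.
  rewrite mulrC EFinM -muleA -(@prob_coin x i n (q y)); last 2 first.
  - exact: q01.
  - apply: other_sourcesI => //; apply: (@sub_other_sources (randomizer i n) chain);
      [by apply/eqP|exact: state_event].
  congr (_ * P x _)%E; apply/seteqP; split => w /=; rewrite /coin /= in_itv /=.
    by move=> [[Aw +] <-].
  by move=> [[Aw <-]].
by apply: measurableI => //; exact: measurable_coin.
Qed.

Definition randomizer_events : set (set W) :=
  <<s \bigcup_(a in [set: player * nat]) sources (randomizer a.1 a.2) >>.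

(** The history of the chain up to [n] together with all randomizers, given by a
pi-system of generators. *)
Definition joint_history n : set (set W) :=
  <<s [set A | exists B C,
    [/\ chain_history X n B, randomizer_events C & A = B `&` C]] >>.

Lemma randomizer_events_sub : randomizer_events `<=` other_sources chain.
Proof.
apply: sub_sigma_algebra2 => A [[i n] _ SA]; exists (randomizer i n) => //; exact/eqP.
Qed.

Lemma joint_history_measurable n : joint_history n `<=` measurable.
Proof.
apply: smallest_sub; first exact: sigma_algebra_measurable.
move=> _ [B [C [hB hC ->]]]; apply: measurableI.
  exact: chain_history_measurable hB.
exact: other_sources_measurable (randomizer_events_sub hC).
Qed.

(** The Markov property survives the enlargement of the history, because the
randomizers are independent of the whole chain. *)
Lemma prob_transition x n z B A : joint_history n A ->
  P x (A `&` (X n @^-1` [set z] `&` X n.+1 @^-1` B)) =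
  (Pi z B * P x (A `&` X n @^-1` [set z]))%E.
Proof.
move=> hA.
have fin : Pi z B \is a fin_num.
  rewrite ge0_fin_numE// (le_lt_trans _ (ltry 1))// -(@prob_kernel _ _ _ _ _ Pi z).
  by apply: le_measure; rewrite ?inE.
rewrite -(fineK fin).
apply: (prob_scale_g_sigma_algebra _ _ _ _ _ _ _ hA).
- by rewrite fine_ge0.
- move=> ? h; apply: (@joint_history_measurable n); exact: sub_sigma_algebra.
- move=> _ _ [B1 [C1 [hB1 hC1 ->]]] [B2 [C2 [hB2 hC2 ->]]].
  exists (B1 `&` B2), (C1 `&` C2); split; last by rewrite setIACA.
    exact: chain_historyI.
  by apply: sigma_algebraI hC1 hC2; exact: smallest_sigma_algebra.
- exists setT, setT; split; last by rewrite setIT.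
    by apply: sigma_algebraT; exact: smallest_sigma_algebra.
  by apply: sigma_algebraT; exact: smallest_sigma_algebra.
- by apply: measurableI; exact: measurable_state.
- exact: measurable_state.
move=> _ [B' [C [hB hC ->]]].
have hBz : chain_history X n (B' `&` X n @^-1` [set z]).
  by apply: chain_historyI => //; exact: chain_history_state.
have sBz := chain_history_sub hBz.
have sC := randomizer_events_sub hC.
rewrite (_ : _ `&` _ = C `&` ((B' `&` X n @^-1` [set z]) `&` X n.+1 @^-1` B));
  last first.
  by rewrite -!setIA setICA.
rewrite (_ : B' `&` C `&` _ = C `&` (B' `&` X n @^-1` [set z])); last first.
  by rewrite -!setIA setICA.
rewrite (source_independent _ sC); last first.
  by apply: source_eventsI => //; exact: state_event.
rewrite (source_independent _ sC sBz) muleA; congr (_ * _)%E.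
have [_ markov] := markovX x.
rewrite (markov n _ _ hBz (discreteE B)) fineK//.
rewrite (integral_fiber discreteE (Y := X n) (c := Pi z B))//; last by move=> w ->.
exact: chain_history_measurable hB.
Qed.

(** On the event that the current state is [z], the next state has law [Pi z]
independently of [A]. *)
Lemma integral_transition x n (phi : E -> \bar R) A :
  (forall y, (0 <= phi y)%E) -> joint_history n A ->
  (\int[P x]_(w in A) phi (X n.+1 w) = \int[P x]_(w in A) \int[Pi (X n w)]_y phi y)%E.
Proof.
move=> phi0 hA; have mA := joint_history_measurable hA.
have mF k D (psi : E -> \bar R) : measurable_fun D (fun w => psi (X k w)).
  apply/measurable_funTS/measurableT_comp => //; exact: measurable_discrete.
apply: (eq_integral_fibers discreteE countableE (Y1 := X n) (Y2 := X n)) => //.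
- exact: (mF n _ (fun z => \int[Pi z]_y phi y)%E).
- by move=> w; exact: integral_ge0.
move=> z.
rewrite [RHS](integral_fiber discreteE (c := (\int[Pi z]_y phi y)%E))//;
  last by move=> w ->.
have mAz : measurable (A `&` X n @^-1` [set z]) by apply: measurableI => //;
  exact: measurable_state.
have fin : P x (A `&` X n @^-1` [set z]) \is a fin_num by exact: fin_num_measure.
have c0 : 0 <= fine (P x (A `&` X n @^-1` [set z])) by rewrite fine_ge0.
transitivity (\int[mscale (NngNum c0) (Pi z)]_y phi y)%E; last first.
  rewrite ge0_integral_mscale//=.
  by rewrite fineK// muleC.
apply: (eq_integral_fibers discreteE countableE (Y1 := X n.+1) (Y2 := id)) => //.
move=> y.
rewrite (integral_fiber discreteE (c := phi y))//; last by move=> w ->.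
rewrite (integral_fiber discreteE (c := phi y) (Y := id))//; last by move=> w ->.
congr (_ * _)%E; rewrite setTI preimage_id -setIA.
transitivity ((fine (P x (A `&` X n @^-1` [set z])))%:E * Pi z [set y])%E => //.
rewrite fineK// muleC. exact: prob_transition.
Qed.

End sources.

(** * Stopping times and payoffs *)

Section times.

Lemma time_lt_SomeS t n : time_lt t (Some n.+1) = time_le_nat t n.
Proof. by case: t. Qed.

Lemma first_time_lt (A : pred nat) n :
  time_lt (first_time A) (Some n) = has A (iota 0 n).
Proof.
rewrite /first_time; case: pselect => [exA|noA] /=.
  case: ex_minnP => m Am min; apply/idP/hasP => [mn|[k]].
    by exists m; rewrite // mem_iota.
  by rewrite mem_iota add0n => kn /min mk; exact: leq_ltn_trans mk kn.
by apply/esym/negbTE/hasPn => k _; apply/negP => Ak; apply: noA; exists k.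
Qed.

Lemma first_time_eq (A : pred nat) n :
  first_time A = Some n <-> A n /\ ~~ time_lt (first_time A) (Some n).
Proof.
rewrite first_time_lt /first_time; case: pselect => [exA|noA] /=; last first.
  by split => // -[An]; exfalso; apply: noA; exists n.
case: ex_minnP => m Am min; split => [[<-]|[An /hasPn h]].
  split => //; apply/hasPn => k; rewrite mem_iota add0n => km.
  by move: km => /= km; apply/negP => /min; rewrite leqNgt km.
congr Some; apply/eqP; rewrite eqn_leq min// leqNgt; apply/negP => mn.
by have := h m; rewrite mem_iota add0n mn => /(_ isT)/negP.
Qed.

Context {R : realType} {dE dW : measure_display}
  {E : measurableType dE} {W : measurableType dW}.
Variable (X : nat -> {mfun W >-> E}).

Definition alive (tau : W -> time) (n : nat) : set W :=
  [set w | ~~ time_lt (tau w) (Some n)].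

Definition stopped (tau : W -> time) (n : nat) : set W :=
  [set w | tau w = Some n].

Lemma alive0 tau : alive tau 0 = setT.
Proof. by apply/seteqP; split=> // w _; rewrite /alive /=; case: (tau w). Qed.

Lemma aliveE tau n : alive tau n = stopped tau n `|` alive tau n.+1.
Proof.
apply/seteqP; rewrite /alive /stopped; split => w /=.
  case: (tau w) => [m|] /=; last by right.
  by rewrite -leqNgt leq_eqVlt => /predU1P[->|nm]; [left|right; rewrite -leqNgt].
case: (tau w) => [m|] //= [[->]|]; first by rewrite ltnn.
by rewrite -!leqNgt => /ltnW.
Qed.

Lemma stopped_aliveS tau n : stopped tau n `&` alive tau n.+1 = set0.
Proof.
rewrite -subset0 => w [] /=; rewrite /alive /stopped /= => -> /=.
by rewrite ltnS leqnn.
Qed.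

Lemma stoppedE tau n : stopped tau n = alive tau n `\` alive tau n.+1.
Proof.
rewrite aliveE setDUl setDv setU0 setDE; apply/esym/setIidPl => w sw aw.
have : (stopped tau n `&` alive tau n.+1) w by [].
by rewrite stopped_aliveS.
Qed.

Variables (xi : player -> nat -> {mfun W >-> R}).

Lemma alive_randomized_timeS i p n :
  alive (randomized_time X xi i p) n.+1 =
  alive (randomized_time X xi i p) n `\` coin X xi i n p.
Proof.
apply/seteqP; split => w; rewrite /alive /randomized_time /coin /= !first_time_lt.
  by rewrite -addn1 iotaD has_cat negb_or /= orbF => /andP[h /negP].
by move=> [h /negP c]; rewrite -addn1 iotaD has_cat negb_or /= orbF h.
Qed.

Lemma stopped_randomized_time i p n :
  stopped (randomized_time X xi i p) n =
  alive (randomized_time X xi i p) n `&` coin X xi i n p.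
Proof.
apply/seteqP; split => w; rewrite /stopped /alive /randomized_time /coin /=.
  by move=> /first_time_eq[].
by move=> [a b]; apply/first_time_eq.
Qed.

Section payoffs.
Variables (alpha : R) (f g h : E -> R) (tau rho : W -> time) (n : nat) (w : W).

Let pay := payoff X alpha f g h tau rho w.

Lemma payoff_own : stopped tau n w -> alive rho n.+1 w ->
  pay = alpha ^+ n * f (X n w).
Proof.
rewrite /pay /payoff /stopped /alive /discounted /= => ->.
case: (rho w) => [m|] /=; last by rewrite !mulr0 mulr1 !addr0.
rewrite -leqNgt => nm; rewrite nm ltnNge (ltnW nm) /= !mulr0 mulr1.
by rewrite (_ : (Some n == Some m) = (n == m))// ltn_eqF// !mulr0 !addr0.
Qed.

Lemma payoff_other : alive tau n.+1 w -> stopped rho n w ->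
  pay = alpha ^+ n * g (X n w).
Proof.
rewrite /pay /payoff /stopped /alive /discounted /= => + ->.
case: (tau w) => [m|] /=; last by rewrite !mul0r mulr1 addr0 add0r.
rewrite -leqNgt => nm; rewrite nm ltnNge (ltnW nm) /= !mulr0 mulr1.
by rewrite (_ : (Some m == Some n) = (m == n))// gtn_eqF// !mulr0 addr0 add0r.
Qed.

Lemma payoff_both : stopped tau n w -> stopped rho n w ->
  pay = alpha ^+ n * h (X n w).
Proof.
rewrite /pay /payoff /stopped /alive /discounted /= => -> -> /=.
by rewrite ltnn eqxx !mulr0 !add0r mulr1.
Qed.

Lemma payoff_never : (forall k, alive tau k w /\ alive rho k w) -> pay = 0.
Proof.
move=> a; rewrite /pay /payoff /discounted.
have : tau w = None.
  by case e: (tau w) => [m|//]; have [+ _] := a m.+1; rewrite /alive /= e /= ltnS leqnn.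
have : rho w = None.
  by case e: (rho w) => [m|//]; have [_ +] := a m.+1; rewrite /alive /= e /= ltnS leqnn.
by move=> -> -> /=; rewrite !mul0r !addr0.
Qed.
End payoffs.
End times.

Section histories.
Context {R : realType} {dE dW : measure_display}
  {E : measurableType dE} {W : measurableType dW}.
Variables (discreteE : forall A : set E, measurable A).
Variables (countableE : countable [set: E]).
Variables (X : nat -> {mfun W >-> E})
    (xi : player -> nat -> {mfun W >-> R}) (T : {mfun W >-> nat}).

Lemma player_history_sub (S : set (set W)) i n : sigma_algebra setT S ->
  (forall k, (k <= n)%N -> g_sigma_algebra_preimage (X k) `<=` S) ->
  (forall k, (k <= n)%N -> g_sigma_algebra_preimage (xi i k) `<=` S) ->
  player_history X xi i n `<=` S.
Proof.
move=> sS SX Sxi; apply: smallest_sub => // A [k /= kn [|]]; [exact: SX|exact: Sxi].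
Qed.

Lemma player_history_joint i n : player_history X xi i n `<=` joint_history X xi T n.
Proof.
apply: player_history_sub; first exact: smallest_sigma_algebra.
  move=> k kn A XA; apply: sub_sigma_algebra; exists A, setT; split;
    last by rewrite setIT.
    by apply: sub_sigma_algebra; exists k.
  by apply: sigma_algebraT; exact: smallest_sigma_algebra.
move=> k kn A XA; apply: sub_sigma_algebra; exists setT, A; split;
  last by rewrite setTI.
  by apply: sigma_algebraT; exact: smallest_sigma_algebra.
by apply: sub_sigma_algebra; exists (i, k).
Qed.

Lemma player_history_other i k j n :
  (forall m, (m <= k)%N -> randomizer i m != randomizer j n) ->
  player_history X xi i k `<=` other_sources X xi T (randomizer j n).
Proof.
move=> ij; apply: player_history_sub; first exact: smallest_sigma_algebra.
  move=> m mk A XA; apply: (@sub_other_sources _ _ _ _ _ _ _ _ _ chain);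
    first exact/eqP.
  by apply: sub_sigma_algebra; exists m.
by move=> m mk A XA; apply: sub_sigma_algebra; exists (randomizer i m) => //=;
  exact: ij.
Qed.

Lemma player_history_coin i n k p : (k <= n)%N ->
  player_history X xi i n (coin X xi i k p).
Proof.
move=> kn.
have -> : coin X xi i k p = \bigcup_y (X k @^-1` [set y] `&` xi i k @^-1` `]-oo, p y]).
  apply/seteqP; split => w; rewrite /coin /=.
    by move=> c; exists (X k w) => //; split => //=; rewrite in_itv.
  by move=> [y _ [/= <-]]; rewrite in_itv.
apply: (@countable_bigcupT_measurable _ (g_sigma_algebraType _) E _ countableE) => y.
apply: (sigma_algebraI (smallest_sigma_algebra _ _)).
  apply: sub_sigma_algebra; exists k => //; left; exists [set y] => //;
    by rewrite setTI.
by apply: sub_sigma_algebra; exists k => //; right; exists `]-oo, p y]%classic => //;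
  rewrite setTI.
Qed.

Lemma randomized_time_stopping i p : stopping_times X xi i (randomized_time X xi i p).
Proof.
move=> n /=.
have -> : [set w | time_le_nat (randomized_time X xi i p w) n] =
    \bigcup_(k in `I_n.+1) coin X xi i k p.
  apply/seteqP; split => w /=; rewrite -time_lt_SomeS first_time_lt.
    by move=> /hasP[k]; rewrite mem_iota add0n => kn c; exists k.
  by move=> [k kn c]; apply/hasP; exists k; rewrite ?mem_iota.
apply: (@bigcup_measurable _ (g_sigma_algebraType _)) => k kn.
exact: player_history_coin.
Qed.

Lemma alive_sub (S : set (set W)) i tau n : sigma_algebra setT S ->
  stopping_times X xi i tau ->
  (forall m, (m < n)%N -> player_history X xi i m `<=` S) -> S (alive tau n).
Proof.
move=> sS st hS; case: n hS => [|n] hS; first by rewrite alive0; exact: sigma_algebraT.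
have -> : alive tau n.+1 = setT `\` [set w | time_le_nat (tau w) n].
  apply/seteqP; split => w; rewrite /alive /= time_lt_SomeS; first by move=> /negP.
  by case=> _ /negP.
have [_ SC _] := sS; apply: SC; apply: (hS n) => //; exact: st.
Qed.

End histories.

(** * Verification of stage equilibria *)

Section verification.
Context {R : realType} {dE dW : measure_display}
  {E : measurableType dE} {W : measurableType dW}.
Variables (discreteE : forall A : set E, measurable A).
Variables (countableE : countable [set: E]).
Variables (P : E -> probability W R) (X : nat -> {mfun W >-> E})
    (xi : player -> nat -> {mfun W >-> R}) (T : {mfun W >-> nat}).
Variable Pi : R.-pker E ~> E.
Hypotheses (markovX : markov_process P X Pi)
    (uniform_xi : uniform_randomizers P xi)
    (independent : independent_sources P X xi T).
Variables (alpha : R) (alpha0 : 0 < alpha) (M : E -> R).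
Hypothesis M0 : forall y, 0 <= M y.
Hypothesis iM : forall y, (Pi y).-integrable setT (EFin \o M).
Hypothesis sM : forall y, alpha * (\int[Pi y]_z M z)%R <= M y.
Hypothesis iMX : forall x n, (P x).-integrable setT (fun w => (M (X n w))%:E).
Hypothesis tailM : forall x,
  alpha ^+ n * (\int[P x]_w M (X n w))%R @[n --> \oo] --> (0 : R).

Implicit Types (phi psi : E -> R).

Definition dominated phi := exists c : R, forall y, `|phi y| <= c * M y.

Lemma dominated_le phi : (forall y, `|phi y| <= M y) -> dominated phi.
Proof. by move=> h; exists 1 => y; rewrite mul1r. Qed.

Lemma dominatedD phi psi : dominated phi -> dominated psi ->
  dominated (fun y => phi y + psi y).
Proof.
move=> [a ha] [b hb]; exists (a + b) => y.
by rewrite mulrDl (le_trans (ler_normD _ _))// lerD.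
Qed.

Lemma dominatedM q phi : (forall y, `|q y| <= 1) -> dominated phi ->
  dominated (fun y => q y * phi y).
Proof.
move=> q1 [a ha]; exists a => y; rewrite normrM.
by apply: le_trans (ha y); rewrite ler_piMl.
Qed.

Lemma dominatedN phi : dominated phi -> dominated (fun y => - phi y).
Proof. by move=> [a ha]; exists a => y; rewrite normrN. Qed.

Lemma measurable_at_state n D phi : measurable_fun D (fun w => phi (X n w)).
Proof. exact/measurable_funTS/measurableT_comp. Qed.

Lemma integrable_at_state x n D phi : measurable D -> dominated phi ->
  (P x).-integrable D (fun w => (phi (X n w))%:E).
Proof.
move=> mD [c hc]; apply: (@integrableS _ _ _ _ setT) => //.
apply: (le_Rintegrable (g := fun w => c * M (X n w))) => //.
  exact: measurable_at_state.
exact: (integrableZl (f := fun w => (M (X n w))%:E) measurableT c (iMX x n)).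
Qed.

Lemma integrable_kernel y phi : dominated phi -> (Pi y).-integrable setT (EFin \o phi).
Proof.
move=> [c hc]; apply: (le_Rintegrable (g := fun z => c * M z)) => //.
exact: (integrableZl measurableT c (iM y)).
Qed.

Lemma dominated_kernel phi : dominated phi ->
  dominated (fun y => (\int[Pi y]_z phi z)%R).
Proof.
move=> dphi; have [c hc] := dphi; exists (`|c| / alpha) => y.
rewrite (le_trans (le_normr_Rintegral _ (integrable_kernel y dphi)))//.
rewrite (@le_trans _ _ (`|c| * (\int[Pi y]_z M z)%R))//; last first.
  by rewrite -mulrA ler_wpM2l// ler_pdivlMl.
rewrite -RintegralZl//; apply: le_Rintegral => //.
- by apply: (@integrable_kernel _ (fun z => `|phi z|)); exists c => z; rewrite normr_id.
- by apply: (@integrable_kernel _ (fun z => `|c| * M z)); exists `|c| => z;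
    rewrite ger0_norm// mulr_ge0.
- by move=> z _; rewrite (le_trans (hc z))// ler_wpM2r// ler_norm.
Qed.

Definition avg x n (A : set W) phi : R := (\int[P x]_(w in A) phi (X n w))%R.

Lemma avgD x n A phi psi : measurable A -> dominated phi -> dominated psi ->
  avg x n A (fun y => phi y + psi y) = avg x n A phi + avg x n A psi.
Proof. by move=> mA dphi dpsi; apply: RintegralD => //; exact: integrable_at_state. Qed.

Lemma avgB x n A phi psi : measurable A -> dominated phi -> dominated psi ->
  avg x n A (fun y => phi y - psi y) = avg x n A phi - avg x n A psi.
Proof. by move=> mA dphi dpsi; apply: RintegralB => //; exact: integrable_at_state. Qed.

Lemma avgU x n A B phi : measurable A -> measurable B -> A `&` B = set0 ->
  dominated phi -> avg x n (A `|` B) phi = avg x n A phi + avg x n B phi.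
Proof.
move=> mA mB AB dphi; apply: Rintegral_setU => //; last exact/eqP.
by apply: integrable_at_state => //; exact: measurableU.
Qed.

Lemma eq_avg x n A phi psi : (forall y, phi y = psi y) -> avg x n A phi = avg x n A psi.
Proof. by move=> e; congr avg; exact/funext. Qed.

(** Both sides are linear in [phi], and [phi] is the difference of the
nonnegative functions [phi + c * M] and [c * M]; the same device proves
[avg_transition]. *)
Lemma avg_coin x i n q A phi : (forall y, 0 <= q y <= 1) -> dominated phi ->
  other_sources X xi T (randomizer i n) A ->
  avg x n (A `&` coin X xi i n q) phi = avg x n A (fun y => q y * phi y).
Proof.
move=> q01 dphi SA; have mA := other_sources_measurable SA.
have mAc : measurable (A `&` coin X xi i n q).
  by apply: measurableI => //; exact: measurable_coin.
have q1 y : `|q y| <= 1 by have /andP[a b] := q01 y; rewrite ger0_norm.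
have pos psi : (forall y, 0 <= psi y) ->
    avg x n (A `&` coin X xi i n q) psi = avg x n A (fun y => q y * psi y).
  move=> psi0; rewrite /avg /Rintegral.
  by rewrite (integral_coin discreteE countableE uniform_xi independent).
have [c hc] := dphi.
pose cM y := `|c| * M y.
have cM0 y : 0 <= cM y by rewrite mulr_ge0.
have dcM : dominated cM by exists `|c| => y; rewrite ger0_norm.
have e y : phi y = (phi y + cM y) - cM y by rewrite addrK.
rewrite (eq_avg _ _ _ e) avgB//; last exact: dominatedD.
rewrite !pos//; last first.
  move=> y; rewrite -[phi y]opprK addrC subr_ge0 (le_trans (ler_norm _))// normrN.
  by rewrite (le_trans (hc y))// ler_wpM2r// ler_norm.
rewrite -avgB//; last first.
- exact: dominatedM.
- by apply: dominatedM => //; exact: dominatedD.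
by apply: eq_avg => y; rewrite -mulrBr addrK.
Qed.

Lemma avg_coinC x i n q A phi : (forall y, 0 <= q y <= 1) -> dominated phi ->
  other_sources X xi T (randomizer i n) A ->
  avg x n (A `\` coin X xi i n q) phi = avg x n A (fun y => (1 - q y) * phi y).
Proof.
move=> q01 dphi SA; have mA := other_sources_measurable SA.
have mc : measurable (coin X xi i n q) by exact: measurable_coin.
have q1 y : `|q y| <= 1 by have /andP[a b] := q01 y; rewrite ger0_norm.
have := avgU x n (A := A `&` coin X xi i n q) (B := A `\` coin X xi i n q) _ _ _ dphi.
rewrite setUIDK avg_coin// => h.
have -> : avg x n A (fun y => (1 - q y) * phi y) =
  avg x n A phi - avg x n A (fun y => q y * phi y).
  rewrite -avgB//; last exact: dominatedM.
  by apply: eq_avg => y; rewrite mulrBl mul1r.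
rewrite h; first by rewrite addrC addKr.
- exact: measurableI.
- exact: measurableD.
- by rewrite setIDA setDE -setIA -!setIA [X in _ `&` X]setIC -!setIA setICl !setI0.
Qed.

Lemma avg_transition x n A phi : dominated phi -> joint_history X xi T n A ->
  avg x n.+1 A phi = avg x n A (fun y => (\int[Pi y]_z phi z)%R).
Proof.
move=> dphi hA; have mA := joint_history_measurable hA.
have [c hc] := dphi.
pose cM y := `|c| * M y.
have cM0 y : 0 <= cM y by rewrite mulr_ge0.
have dcM : dominated cM by exists `|c| => y; rewrite ger0_norm.
have pos psi : (forall y, 0 <= psi y) -> dominated psi ->
    avg x n.+1 A psi = avg x n A (fun y => (\int[Pi y]_z psi z)%R).
  move=> psi0 dpsi; rewrite /avg /Rintegral.
  rewrite (integral_transition discreteE countableE markovX independent x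
    (phi := EFin \o psi))//.
  congr fine; apply: eq_integral => w _; rewrite fineK//.
  by apply: integrable_fin_num => //; exact: integrable_kernel.
have e y : phi y = (phi y + cM y) - cM y by rewrite addrK.
rewrite (eq_avg _ _ _ e) avgB//; last exact: dominatedD.
rewrite !pos//; last 2 first.
- move=> y; rewrite -[phi y]opprK addrC subr_ge0 (le_trans (ler_norm _))// normrN.
  by rewrite (le_trans (hc y))// ler_wpM2r// ler_norm.
- exact: dominatedD.
rewrite -avgB//; last 2 first.
- by apply: dominated_kernel; exact: dominatedD.
- exact: dominated_kernel.
apply: eq_avg => y; rewrite -RintegralB//.
- by apply: eq_Rintegral => z _; rewrite addrK.
- by apply: integrable_kernel; exact: dominatedD.
- exact: integrable_kernel.
Qed.

Section fixed_opponent.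
Variables (i : player) (q : E -> R) (f g h V : E -> R) (m : E -> R).
Hypothesis q01 : forall y, 0 <= q y <= 1.
Hypothesis fM : forall y, `|f y| <= M y.
Hypothesis gM : forall y, `|g y| <= M y.
Hypothesis hM : forall y, `|h y| <= M y.
Hypothesis VM : forall y, `|V y| <= M y.
Hypothesis fm : forall y, `|f y| <= m y.
Hypothesis gm : forall y, `|g y| <= m y.
Hypothesis hm : forall y, `|h y| <= m y.
Variable x : E.
Hypothesis im : (P x).-integrable setT (fun w =>
  \sum_(k <oo) (alpha ^+ k * m (X k w))%:E)%E.

Let rho := randomized_time X xi (~~ i) q.
Let D n := coin X xi (~~ i) n q.
Let stop y := stop_value f h (q y) y.
Let cont y := continue_value Pi alpha g V (q y) y.

Variable tau : W -> time.
Hypothesis st_tau : stopping_times X xi i tau.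

Let pay := payoff X alpha f g h tau rho.
(** While [r n] holds nobody has stopped before [n].  At time [n], [S n] and
[C n] say that the player stops or goes on, and [D n] that the opponent's coin
tells the opponent to stop; the game ends at [n] on [S n `\` D n],
[S n `&` D n] and [C n `&` D n], and otherwise [r n.+1] holds. *)
Let r n := alive tau n `&` alive rho n.
Let S n := stopped tau n `&` alive rho n.
Let C n := alive tau n.+1 `&` alive rho n.

Let rand_neq k j : randomizer i k != randomizer (~~ i) j.
Proof.
have neqN (b : bool) : b <> ~~ b by case: b.
apply/eqP => e; apply: (@neqN i).
exact: (congr1 (fun s => if s is randomizer b _ then b else i) e).
Qed.

Let randS_neq b k j : (k < j)%N -> randomizer b k != randomizer b j.
Proof.
move=> kj; apply/eqP => /(congr1 (fun s => if s is randomizer _ l then l else 0%N)) e.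
by move: kj => /=; rewrite e ltnn.
Qed.

Let st_rho : stopping_times X xi (~~ i) rho.
Proof. exact: randomized_time_stopping. Qed.

Let other_alive_tau k n : other_sources X xi T (randomizer (~~ i) n) (alive tau k).
Proof.
apply: (alive_sub (i := i) _ st_tau); first exact: smallest_sigma_algebra.
by move=> j _; apply: player_history_other => l _.
Qed.

Let other_alive_rho n : other_sources X xi T (randomizer (~~ i) n) (alive rho n).
Proof.
apply: (alive_sub (i := ~~ i) _ st_rho); first exact: smallest_sigma_algebra.
move=> j jn; apply: player_history_other => l lj.
by apply: randS_neq; exact: leq_ltn_trans jn.
Qed.

Let other_C n : other_sources X xi T (randomizer (~~ i) n) (C n).
Proof. exact: other_sourcesI. Qed.

Let other_S n : other_sources X xi T (randomizer (~~ i) n) (S n).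
Proof.
apply: other_sourcesI => //; rewrite stoppedE.
by apply: (sigma_algebraD (smallest_sigma_algebra _ _)); exact: other_alive_tau.
Qed.

Let player_history_le b j n : (j < n.+1)%N ->
  player_history X xi b j `<=` player_history X xi b n.
Proof.
move=> jn; apply: sub_sigma_algebra2 => A [k kj hA]; exists k => //.
exact: leq_trans kj jn.
Qed.

Let joint_r n : joint_history X xi T n (r n.+1).
Proof.
apply: (sigma_algebraI (smallest_sigma_algebra _ _)).
  apply: (alive_sub _ st_tau); first exact: smallest_sigma_algebra.
  by move=> j jn A hA; apply: player_history_joint; exact: player_history_le jn _ hA.
apply: (alive_sub _ st_rho); first exact: smallest_sigma_algebra.
by move=> j jn A hA; apply: player_history_joint; exact: player_history_le jn _ hA.
Qed.

Let mS n : measurable (S n).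
Proof. by have /other_sources_measurable := @other_S n. Qed.

Let mC n : measurable (C n).
Proof. by have /other_sources_measurable := @other_C n. Qed.

Let mD n : measurable (D n).
Proof. exact: measurable_coin. Qed.

Let r_split n : r n = S n `|` C n.
Proof. by rewrite /r aliveE setIUl. Qed.

Let SC0 n : S n `&` C n = set0.
Proof. by rewrite /S /C setIACA stopped_aliveS set0I. Qed.

Let rS n : r n.+1 = C n `\` D n.
Proof. by rewrite /r /C alive_randomized_timeS setIDA. Qed.

Let mr n : measurable (r n).
Proof. by rewrite r_split; exact: measurableU. Qed.

Let r_decr n : r n.+1 `<=` r n.
Proof. by rewrite rS r_split => w [Cw _]; right. Qed.

Let not_rS n :
  ~` r n.+1 = ~` r n `|` ((S n `\` D n `|` S n `&` D n) `|` C n `&` D n).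
Proof.
rewrite setUC (setUC (S n `\` D n)) setUIDK rS setDE setCI setCK.
rewrite r_split; apply/seteqP; split => w.
  have [Sw _|Sw] := pselect (S n w); first by left; left.
  have [Cw [//|Dw]|Cw _] := pselect (C n w); first by left; right.
  by right => -[].
move=> [[Sw|[Cw Dw]]|];
  [left => Cw|by right|move=> SC; left => Cw; apply: SC; by right].
have : (S n `&` C n) w by [].
by rewrite SC0.
Qed.

Let paySD n w : (S n `\` D n) w -> pay w = alpha ^+ n * f (X n w).
Proof.
move=> [[sw aw] Dw]; apply: payoff_own => //.
by rewrite alive_randomized_timeS.
Qed.

Let paySI n w : (S n `&` D n) w -> pay w = alpha ^+ n * h (X n w).
Proof.
move=> [[sw aw] Dw]; apply: payoff_both => //.
by rewrite stopped_randomized_time.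
Qed.

Let payCI n w : (C n `&` D n) w -> pay w = alpha ^+ n * g (X n w).
Proof.
move=> [[sw aw] Dw]; apply: payoff_other => //.
by rewrite stopped_randomized_time.
Qed.

Let pay_cases w : (forall n, r n w) \/ exists n,
  [\/ (S n `\` D n) w, (S n `&` D n) w | (C n `&` D n) w].
Proof.
have [h0|h0] := pselect (exists n,
  [\/ (S n `\` D n) w, (S n `&` D n) w | (C n `&` D n) w]).
  by right.
left; elim=> [|n IHn]; first by rewrite /r !alive0.
apply: contrapT => nr; apply: h0; exists n.
have : (~` r n.+1) w by [].
by rewrite not_rS => -[//|[[a|a]|a]]; [constructor 1|constructor 2|constructor 3].
Qed.

Let mpay : measurable_fun setT pay.
Proof.
(* The payoff is 0 where nobody ever stops, and a function of the current state
   on each of the countably many events where the game ends. *)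
pose N := \bigcap_n r n.
have mN : measurable N by exact: bigcapT_measurable.
have -> : [set: W] = N `|` (\bigcup_n (S n `\` D n) `|`
    (\bigcup_n (S n `&` D n) `|` \bigcup_n (C n `&` D n))).
  apply/esym/seteqP; split => // w _; have [rw|[n [a|a|a]]] := pay_cases w.
  - by left => n _.
  - by right; left; exists n.
  - by right; right; left; exists n.
  - by right; right; right; exists n.
have m1 n : measurable (S n `\` D n) by exact: measurableD.
have m2 n : measurable (S n `&` D n) by exact: measurableI.
have m3 n : measurable (C n `&` D n) by exact: measurableI.
have mst n A phi : measurable_fun A (fun w => alpha ^+ n * phi (X n w)).
  exact: (@measurable_at_state n A (fun y => alpha ^+ n * phi y)).
apply/measurable_funU => //.
  by do 2 (apply: measurableU; first exact: bigcupT_measurable);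
    exact: bigcupT_measurable.
split.
  apply: (@eq_measurable_fun _ _ _ _ N (cst (0:R))) => // w; rewrite inE => Nw.
  by rewrite /pay payoff_never// => k; have [] := Nw k Logic.I.
apply/measurable_funU; [exact: bigcupT_measurable|
  by apply: measurableU; exact: bigcupT_measurable|].
split.
  apply/measurable_fun_bigcup => // n.
  apply: (@eq_measurable_fun _ _ _ _ _ (fun w => alpha ^+ n * f (X n w))) => //.
  by move=> w; rewrite inE => /paySD.
apply/measurable_funU; [exact: bigcupT_measurable|exact: bigcupT_measurable|split].
  apply/measurable_fun_bigcup => // n.
  apply: (@eq_measurable_fun _ _ _ _ _ (fun w => alpha ^+ n * h (X n w))) => //.
  by move=> w; rewrite inE => /paySI.
apply/measurable_fun_bigcup => // n.
apply: (@eq_measurable_fun _ _ _ _ _ (fun w => alpha ^+ n * g (X n w))) => //.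
by move=> w; rewrite inE => /payCI.
Qed.

Let ipay : (P x).-integrable setT (EFin \o pay).
Proof.
apply: le_integrable im => //; first exact/measurable_EFinP.
move=> w _ /=.
have m0 y : 0 <= m y by exact: le_trans (fm y).
have t0 k : (0 <= (alpha ^+ k * m (X k w))%:E)%E.
  by rewrite lee_fin mulr_ge0// exprn_ge0// ltW.
rewrite [leRHS]gee0_abs; last by apply: nneseries_ge0 => k _ _.
(* The payoff is bounded by a single term of the discounted sum of [m]. *)
have term n phi : `|phi (X n w)| <= m (X n w) -> pay w = alpha ^+ n * phi (X n w) ->
    (`|(pay w)%:E| <= \sum_(k <oo) (alpha ^+ k * m (X k w))%:E)%E.
  move=> hphi ->.
  apply: (@le_trans _ _ (\sum_(0 <= k < n.+1) (alpha ^+ k * m (X k w))%:E)%E);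
    last first.
    by apply: nneseries_lim_ge.
  rewrite big_nat_recr//=; apply: (@le_trans _ _ (alpha ^+ n * m (X n w))%:E).
    have a0 : 0 <= alpha ^+ n by rewrite exprn_ge0// ltW.
    by rewrite lee_fin normrM (ger0_norm a0) ler_wpM2l.
  by rewrite leeDr// sume_ge0.
have [rw|[n [a|a|a]]] := pay_cases w.
- by rewrite /pay payoff_never//= normr0 nneseries_ge0.
- exact: term (paySD a).
- exact: term (paySI a).
- exact: term (payCI a).
Qed.

Let dstop : dominated stop.
Proof. by apply: dominated_le => y; exact: norm_mix. Qed.

Let dcont : dominated cont.
Proof.
apply: dominated_le => y; rewrite /cont /continue_value addrC; apply: norm_mix => //.
by apply: norm_continuation => //; exact: ltW.
Qed.

(** The payoff collected before [n], plus what the value function promises for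
the part of the game that is still running. *)
Let Phi n := (\int[P x]_(w in ~` r n) pay w)%R + alpha ^+ n * avg x n (r n) V.

Let pay_piece n A phi : measurable A -> dominated phi ->
  (forall w, A w -> pay w = alpha ^+ n * phi (X n w)) ->
  (\int[P x]_(w in A) pay w)%R = alpha ^+ n * avg x n A phi.
Proof.
move=> mA dphi e; rewrite /avg -RintegralZl//; last exact: integrable_at_state.
by apply: eq_Rintegral => w; rewrite inE => /e.
Qed.

(** One round replaces [V] by the payoff of the action taken in the stage game,
against an opponent whose coin averages to [q]. *)
Lemma Phi_succ n : Phi n.+1 = Phi n +
  alpha ^+ n * (avg x n (S n) (fun y => stop y - V y) +
                avg x n (C n) (fun y => cont y - V y)).
Proof.
have q1 y : `|q y| <= 1 by have /andP[a b] := q01 y; rewrite ger0_norm.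
have q1' y : `|1 - q y| <= 1 by have /andP[a b] := q01 y; rewrite ger0_norm; lra.
have [df [dg [dh dV]]] : dominated f /\ dominated g /\ dominated h /\ dominated V.
  by do !split; exact: dominated_le.
have dcV : dominated (continuation Pi alpha V).
  by apply: dominated_le => y; apply: norm_continuation => //; exact: ltW.
have m1 : measurable (S n `\` D n) by exact: measurableD.
have m2 : measurable (S n `&` D n) by exact: measurableI.
have m3 : measurable (C n `&` D n) by exact: measurableI.
have iA A : measurable A -> (P x).-integrable A (EFin \o pay).
  by move=> mA; apply: (integrableS (E := setT)).
have m4 : measurable (S n `\` D n `|` S n `&` D n) by exact: measurableU.
have m5 : measurable (S n `\` D n `|` S n `&` D n `|` C n `&` D n).
  exact: measurableU.
rewrite /Phi not_rS Rintegral_setU//; last 3 first.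
- exact: measurableC.
- by apply: iA; apply: measurableU => //; exact: measurableC.
- apply/eqP; rewrite -subset0 => w [nr rw]; apply: nr; rewrite r_split.
  by move: rw => [[[]|[]]|[]]; [left|left|right].
rewrite Rintegral_setU//; last 2 first.
- exact: iA.
- apply/eqP; rewrite -subset0 => w [+ [Cw _]];
    rewrite (setUC (S n `\` D n)) setUIDK => Sw.
  by have : (S n `&` C n) w by []; rewrite SC0.
rewrite Rintegral_setU//; last 2 first.
- exact: iA.
- by apply/eqP; rewrite -subset0 => w [[_ nD] [_ /nD]].
rewrite (pay_piece m1 df (@paySD n)) (pay_piece m2 dh (@paySI n)).
rewrite (pay_piece m3 dg (@payCI n)).
rewrite (avg_transition x dV (@joint_r n)) rS.
rewrite avg_coinC// !avg_coin// avg_coinC//; last exact: dominated_kernel.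
rewrite r_split (avgU _ _ _ _ (SC0 n))//.
rewrite (@avgB _ _ (S n))// (@avgB _ _ (C n))//.
rewrite /stop /stop_value /cont /continue_value.
rewrite (@avgD _ _ (S n))//; [|exact: dominatedM|exact: dominatedM].
rewrite (@avgD _ _ (C n))//; [|exact: dominatedM|exact: dominatedM].
have -> : avg x n (C n) (fun y => (1 - q y) * continuation Pi alpha V y) =
   alpha * avg x n (C n) (fun y => (1 - q y) * (\int[Pi y]_z V z)%R).
  rewrite /avg -RintegralZl//; last first.
    apply: (@integrable_at_state x n _
      (fun y => (1 - q y) * (\int[Pi y]_z V z)%R)) => //.
    by apply: dominatedM => //; exact: dominated_kernel.
  by apply: eq_Rintegral => w _; rewrite /continuation mulrCA.
rewrite exprS; ring.
Qed.

Let Phi0 : Phi 0 = V x.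
Proof.
have rT : r 0 = setT by rewrite /r !alive0 setIT.
rewrite /Phi rT setCT Rintegral_set0 add0r expr0 mul1r /avg /Rintegral.
rewrite (ae_eq_integral (cst (V x)%:E))//.
- by rewrite integral_cst//= probability_setT mule1.
- by apply/measurable_EFinP; exact: measurable_at_state.
- by have [+ _] := markovX x; apply: filterS => w -> _.
Qed.

Let not_r_mono n k w : (n <= k)%N -> ~ r n w -> ~ r k w.
Proof. by move=> /subnK <-; elim: (k - n)%N => [//|j IHj] nr /r_decr; exact: IHj. Qed.

Let Phi_cvg : Phi n @[n --> \oo] --> (\int[P x]_w pay w)%R.
Proof.
rewrite -[X in _ --> X]addr0; apply: cvgD.
  (* The collected payoff is eventually constant along each path. *)
  under eq_fun do rewrite Rintegral_mkcond.
  apply: (dominated_cvg_Rintegral (g := fun w => `|pay w|)) => //.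
  - by move=> n; apply/(measurable_restrictT _ _).1 => //;
      [exact: measurableC|exact: measurable_funTS].
  - by apply: (le_Rintegrable (g := fun w => `|pay w|)) => //=;
      [exact: measurableT_comp|move=> w; rewrite normr_id|exact: integrable_norm ipay].
  - by move=> n w; rewrite patchE; case: ifP => // _; rewrite normr0.
  move=> w; have [rw|[n a]] := pay_cases w.
    have -> : pay w = 0 by rewrite /pay payoff_never.
    apply: cvg_near_cst; apply: nearW => n; rewrite patchE memNset//=; exact.
  have nr : (~` r n.+1) w.
    by rewrite not_rS; case: a => a; right; [left; left|left; right|right].
  apply: cvg_near_cst; exists n.+1 => // k /= nk; rewrite patchE mem_set//=.
  exact: not_r_mono nr.
apply/norm_cvg0P; apply: (squeeze_cvgr _ (cvg_cst 0) (tailM x)).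
apply: nearW => n; have an0 : 0 <= alpha ^+ n by rewrite exprn_ge0// ltW.
rewrite normr_ge0 /= normrM (ger0_norm an0) ler_wpM2l//.
rewrite (le_trans (le_normr_Rintegral _ _))//.
  by apply: integrable_at_state => //; exact: dominated_le.
rewrite [leLHS]Rintegral_mkcond; apply: le_Rintegral => //.
- rewrite (_ : EFin \o _ = (fun w => (`|V (X n w)|)%:E) \_ (r n)); last first.
    by apply/funext => w; rewrite /= !patchE; case: ifP.
  apply/(integrable_mkcond _ (mr n)).
  apply: (@integrable_at_state x n _ (fun y => `|V y|)) => //.
  by apply: dominated_le => y; rewrite normr_id.
- exact: iMX.
- by move=> w _; rewrite patchE; case: ifP.
Qed.

Let expectation_pay : ('E_(P x)[pay] = (\int[P x]_w pay w)%R%:E)%E.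
Proof. by rewrite unlock /Rintegral fineK//; exact: integrable_fin_num. Qed.

Lemma expected_payoff_le : (forall y, stop y <= V y) -> (forall y, cont y <= V y) ->
  ('E_(P x)[pay] <= (V x)%:E)%E.
Proof.
move=> stopV contV; rewrite expectation_pay lee_fin.
apply: (cvgr_to_le Phi_cvg); apply: nearW; elim=> [|n IHn]; first by rewrite Phi0.
rewrite Phi_succ (le_trans _ IHn)// gerDl mulr_ge0_le0//;
  first by rewrite exprn_ge0// ltW.
have neg A u : measurable A -> dominated u -> (forall y, u y <= V y) ->
    avg x n A (fun y => u y - V y) <= 0.
  move=> mA du uV; rewrite -oppr_ge0 (_ : - _ = avg x n A (fun y => V y - u y)).
    by apply: Rintegral_ge0 => w _; rewrite subr_ge0.
  by rewrite !avgB ?opprB//; exact: dominated_le.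
by rewrite -[X in _ <= X]addr0 lerD// neg.
Qed.

Lemma expected_payoff_eq (p : E -> R) : (forall y, 0 <= p y <= 1) ->
  tau = randomized_time X xi i p ->
  (forall y, V y = p y * stop y + (1 - p y) * cont y) ->
  ('E_(P x)[pay] = (V x)%:E)%E.
Proof.
move=> p01 taup eV; rewrite expectation_pay; congr EFin.
have PhiV n : Phi n = V x.
  elim: n => [|n IHn]; first exact: Phi0.
  (* The player's own coin at time [n] is independent of [r n] as well. *)
  have hr : other_sources X xi T (randomizer i n) (r n).
    apply: other_sourcesI.
      apply: (alive_sub _ st_tau); first exact: smallest_sigma_algebra.
      move=> j jn; apply: player_history_other => l lj.
      by apply: randS_neq; exact: leq_ltn_trans jn.
    apply: (alive_sub _ st_rho); first exact: smallest_sigma_algebra.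
    by move=> j jn; apply: player_history_other => l lj; rewrite eq_sym;
      exact: rand_neq.
  rewrite Phi_succ IHn.
  have -> : S n = r n `&` coin X xi i n p.
    by rewrite /S /r taup stopped_randomized_time -!setIA [X in _ `&` X]setIC.
  have -> : C n = r n `\` coin X xi i n p.
    by rewrite /C /r taup alive_randomized_timeS !setDE -!setIA [X in _ `&` X]setIC.
  have dV : dominated V by exact: dominated_le.
  have p1 y : `|p y| <= 1 by have /andP[a b] := p01 y; rewrite ger0_norm.
  have p1' y : `|1 - p y| <= 1 by have /andP[a b] := p01 y; rewrite ger0_norm; lra.
  have d1 : dominated (fun y => stop y - V y).
    by apply: dominatedD => //; exact: dominatedN.
  have d2 : dominated (fun y => cont y - V y).
    by apply: dominatedD => //; exact: dominatedN.
  rewrite avg_coin// avg_coinC// -avgD//; [|exact: dominatedM|exact: dominatedM].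
  rewrite (eq_avg _ _ _ (psi := fun=> 0)); last by move=> y; rewrite [V y]eV; ring.
  by rewrite /avg Rintegral_cst// mul0r mulr0 addr0.
have := Phi_cvg; under eq_fun do rewrite PhiV.
by move/(cvg_lim (@Rhausdorff R)) => <-; rewrite lim_cst.
Qed.

End fixed_opponent.
End verification.

(** * The potential of the rewards *)

Section potential.
Context {R : realType} {dE dW : measure_display}
  {E : measurableType dE} {W : measurableType dW}.
Variables (discreteE : forall A : set E, measurable A).
Variables (countableE : countable [set: E]).
Variables (P : E -> probability W R) (X : nat -> {mfun W >-> E})
    (xi : player -> nat -> {mfun W >-> R}) (T : {mfun W >-> nat}).
Variable Pi : R.-pker E ~> E.
Hypotheses (markovX : markov_process P X Pi)
    (independent : independent_sources P X xi T).
Variables (alpha : R) (alpha01 : 0 < alpha < 1).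
Hypothesis geometricT : geometric_killing P alpha T.
Variable (m : E -> R).
Hypothesis m0 : forall y, 0 <= m y.

Let a0 : 0 < alpha. Proof. by case/andP: alpha01. Qed.
Let an0 n : 0 <= alpha ^+ n. Proof. by rewrite exprn_ge0// ltW. Qed.

Fixpoint iterated_kernel (k : nat) (y : E) : \bar R :=
  if k is k'.+1 then (\int[Pi y]_z iterated_kernel k' z)%E else (m y)%:E.

Lemma iterated_kernel_ge0 k y : (0 <= iterated_kernel k y)%E.
Proof.
by elim: k y => [|k IHk] y /=; [rewrite lee_fin|apply: integral_ge0].
Qed.

Let mX n D (phi : E -> \bar R) : measurable_fun D (fun w => phi (X n w)).
Proof. exact/measurable_funTS/measurableT_comp. Qed.

Lemma integral_iterated_kernel x k n :
  (\int[P x]_w iterated_kernel k (X n w) = iterated_kernel (k + n) x)%E.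
Proof.
elim: n k => [|n IHn] k.
  rewrite addn0 (ae_eq_integral (cst (iterated_kernel k x)))//.
    by rewrite integral_cst//= probability_setT mule1.
  by have [+ _] := markovX x; apply: filterS => w -> _.
have hT : joint_history X xi T n setT.
  by apply: sigma_algebraT; exact: smallest_sigma_algebra.
rewrite (integral_transition discreteE countableE markovX independent x
  (iterated_kernel_ge0 k) hT).
by rewrite (IHn k.+1) addSnnS.
Qed.

(** The killing time is independent of the chain. *)
Lemma integral_killing x n :
  (\int[P x]_(w in T @^-1` [set n]) (m (X n w))%:E =
   ((1 - alpha) * alpha ^+ n)%:E * \int[P x]_w (m (X n w))%:E)%E.
Proof.
have c0 : 0 <= (1 - alpha) * alpha ^+ n.
  by rewrite mulr_ge0// subr_ge0 ltW//; case/andP: alpha01.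
have mT : measurable (T @^-1` [set n]).
  by rewrite -[X in measurable X]setTI; exact: measurable_funP.
transitivity (\int[mscale (NngNum c0) (P x)]_w (m (X n w))%:E)%E; last first.
  rewrite ge0_integral_mscale//; first exact: (@mX n _ (EFin \o m)).
  by move=> w _; rewrite lee_fin.
apply: (eq_integral_fibers discreteE countableE (Y1 := X n) (Y2 := X n)) => //.
- exact: (@mX n _ (EFin \o m)).
- exact: (@mX n _ (EFin \o m)).
- by move=> w; rewrite lee_fin.
- by move=> w; rewrite lee_fin.
move=> y.
rewrite (integral_fiber discreteE (c := (m y)%:E))//; last by move=> w ->.
rewrite (integral_fiber discreteE (c := (m y)%:E))//; last by move=> w ->.
congr (_ * _)%E; rewrite setTI.
transitivity (((1 - alpha) * alpha ^+ n)%:E * P x (X n @^-1` [set y]))%E => //.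
rewrite -(geometricT x n) setIC.
apply: (@source_independent _ _ _ _ _ P X xi T independent x killing_time).
  apply: (@sub_other_sources _ _ _ _ _ _ _ _ _ chain); first exact/eqP.
  exact: state_event.
by exists [set n] => //; rewrite setTI.
Qed.

(** Summing [integral_killing] over [n] gives the mean of [m (X T)]. *)
Lemma potential_finite x (Sup : W -> \bar R) :
  (P x).-integrable setT Sup -> (forall w, (0 <= Sup w)%E) ->
  (forall w, ((m (X (T w) w))%:E <= Sup w)%E) ->
  (\sum_(k <oo) (alpha ^+ k)%:E * iterated_kernel k x < +oo)%E.
Proof.
move=> iS S0 mS.
have a1 : 0 < 1 - alpha by rewrite subr_gt0; case/andP: alpha01.
have mT n : measurable (T @^-1` [set n]).
  by rewrite -[X in measurable X]setTI; exact: measurable_funP.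
have mSup := measurable_int _ iS.
have term0 n : (0 <= (alpha ^+ n)%:E * iterated_kernel n x)%E.
  by rewrite mule_ge0 ?lee_fin ?iterated_kernel_ge0.
have h : ((1 - alpha)%:E *
    (\sum_(k <oo) (alpha ^+ k)%:E * iterated_kernel k x) < +oo)%E.
  rewrite -nneseriesZl//; apply: (@le_lt_trans _ _ (\int[P x]_w Sup w)%E); last first.
    by rewrite -ge0_fin_numE ?integral_ge0//; exact: integrable_fin_num.
  have eT : [set: W] = \bigcup_n T @^-1` [set n].
    by apply/esym/seteqP; split => // w _; exists (T w).
  rewrite eT ge0_integral_bigcup//; last 2 first.
  - by rewrite -eT.
  - exact: trivIset_preimage1.
  apply: lee_nneseries => [n _ _|n _]; first by rewrite mule_ge0 ?lee_fin// ltW.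
  rewrite muleA -EFinM -(integral_iterated_kernel x 0 n) -integral_killing.
  apply: ge0_le_integral => //.
  - by move=> w _; rewrite lee_fin.
  - exact: (@mX n _ (EFin \o m)).
  - exact: measurable_funTS.
  - by move=> w /= <-.
move: h; case e: (\sum_(_ <= _ <oo) _)%E => [r||] //.
  by move=> _; rewrite ltry.
by rewrite gt0_muley// lte_fin.
Qed.

Hypothesis finite : forall x,
  (\sum_(k <oo) (alpha ^+ k)%:E * iterated_kernel k x < +oo)%E.

Definition potential x : R :=
  fine (\sum_(k <oo) (alpha ^+ k)%:E * iterated_kernel k x).

Let term0 n x : (0 <= (alpha ^+ n)%:E * iterated_kernel n x)%E.
Proof. by rewrite mule_ge0 ?lee_fin ?iterated_kernel_ge0. Qed.

Lemma potentialE x :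
  (potential x)%:E = (\sum_(k <oo) (alpha ^+ k)%:E * iterated_kernel k x)%E.
Proof. by rewrite fineK// ge0_fin_numE// nneseries_ge0. Qed.

Lemma potential_ge0 x : 0 <= potential x.
Proof. by rewrite fine_ge0// nneseries_ge0. Qed.

Lemma le_potential x : m x <= potential x.
Proof.
rewrite -lee_fin potentialE.
apply: (@le_trans _ _
  (\sum_(0 <= k < 1) (alpha ^+ k)%:E * iterated_kernel k x)%E).
  by rewrite big_nat1 expr0 mul1e.
exact: nneseries_lim_ge.
Qed.

Let integral_series d (S : measurableType d) (mu : {measure set S -> \bar R})
    (Y : S -> E) : measurable_fun setT Y ->
  (\int[mu]_w (potential (Y w))%:E =
   \sum_(k <oo) (alpha ^+ k)%:E * \int[mu]_w iterated_kernel k (Y w))%E.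
Proof.
move=> mY; under eq_integral do rewrite potentialE.
have mk k : measurable_fun setT (fun w => iterated_kernel k (Y w)).
  exact/measurableT_comp.
rewrite integral_nneseries//.
  apply: eq_eseriesr => k _; rewrite ge0_integralZl//.
    by move=> w _; exact: iterated_kernel_ge0.
  by rewrite lee_fin.
by move=> k; exact: measurable_funeM.
Qed.

Lemma integral_potential y :
  (alpha%:E * \int[Pi y]_z (potential z)%:E <= (potential y)%:E)%E.
Proof.
rewrite (@integral_series _ _ (Pi y) id)// -nneseriesZl; last first.
  by move=> k _; rewrite mule_ge0 ?lee_fin// integral_ge0// => z _;
    exact: iterated_kernel_ge0.
rewrite potentialE [leRHS](nneseries_split 0 1)//.
rewrite -(@nneseries_addn _ (fun k => (alpha ^+ k)%:E * iterated_kernel k y)%E)//.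
rewrite [leLHS](_ : _ =
  \sum_(k <oo) (alpha ^+ (k + 1))%:E * iterated_kernel (k + 1) y)%E.
  by rewrite leeDr// sume_ge0.
by apply: eq_eseriesr => k _; rewrite addn1 muleA -EFinM -exprS.
Qed.

Lemma integrable_potential y : (Pi y).-integrable setT (EFin \o potential).
Proof.
apply/integrableP; split; first exact/measurable_EFinP.
under eq_integral do rewrite /= ger0_norm ?potential_ge0//.
have := integral_potential y.
case e: (\int[_]_(_ in _) _)%E => [r||] //.
  by move=> _; rewrite ltry.
by rewrite gt0_muley// ?lte_fin// leye_eq.
Qed.

(** Discounting shifts the series, so the mean of [potential (X n)] is a tail of
a convergent series. *)
Lemma integral_potential_at x n :
  ((alpha ^+ n)%:E * \int[P x]_w (potential (X n w))%:E =
   \sum_(n <= k <oo) (alpha ^+ k)%:E * iterated_kernel k x)%E.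
Proof.
rewrite integral_series// -nneseriesZl; last first.
  by move=> k _; rewrite mule_ge0 ?lee_fin// integral_ge0// => w _;
    exact: iterated_kernel_ge0.
rewrite -(@nneseries_addn _ (fun k => (alpha ^+ k)%:E * iterated_kernel k x)%E n)//.
apply: eq_eseriesr => k _.
by rewrite integral_iterated_kernel muleA -EFinM -exprD addnC.
Qed.

Lemma integrable_potential_at x n :
  (P x).-integrable setT (fun w => (potential (X n w))%:E).
Proof.
apply/integrableP; split; first exact: (@mX n _ (EFin \o potential)).
under eq_integral do rewrite /= ger0_norm ?potential_ge0//.
have : (\sum_(n <= k <oo) (alpha ^+ k)%:E * iterated_kernel k x < +oo)%E.
  apply: le_lt_trans (finite x).
  by rewrite [leRHS](nneseries_split 0 n)// add0n leeDr// sume_ge0.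
rewrite -integral_potential_at.
case e: (\int[_]_(_ in _) _)%E => [r||] //.
  by move=> _; rewrite ltry.
by rewrite gt0_muley// lte_fin exprn_gt0.
Qed.

Lemma potential_tail x :
  alpha ^+ n * (\int[P x]_w potential (X n w))%R @[n --> \oo] --> (0 : R).
Proof.
have := nneseries_tail_cvg (finite x) (fun k _ => term0 k x).
under eq_fun do rewrite -integral_potential_at.
move=> /fine_cvg /=; apply: cvg_trans; apply: near_eq_cvg; apply: nearW => n /=.
by rewrite /Rintegral fineM//; exact: integrable_fin_num (integrable_potential_at x n).
Qed.

Lemma integrable_discounted_sum x :
  (P x).-integrable setT (fun w => \sum_(k <oo) (alpha ^+ k * m (X k w))%:E)%E.
Proof.
have t0 k w : (0 <= (alpha ^+ k * m (X k w))%:E)%E by rewrite lee_fin mulr_ge0.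
have mk k : measurable_fun setT (fun w => (alpha ^+ k * m (X k w))%:E).
  exact: (@mX k _ (fun y => (alpha ^+ k * m y)%:E)).
apply/integrableP; split; first exact: ge0_emeasurable_sum.
under eq_integral do rewrite gee0_abs ?nneseries_ge0//.
rewrite integral_nneseries//; apply: le_lt_trans (finite x).
apply: lee_nneseries => [k _ _|k _]; first by apply: integral_ge0.
under eq_integral do rewrite EFinM.
rewrite ge0_integralZl//.
- by rewrite (integral_iterated_kernel x 0 k).
- exact: (@mX k _ (EFin \o m)).
- by move=> w _; rewrite lee_fin.
- by rewrite lee_fin.
Qed.
End potential.

(** * Existence of an equilibrium *)

Theorem theorem7p1 (R : realType) (dE dW : measure_display)
    (E : measurableType dE) (W : measurableType dW)
    (countableE : countable [set: E])
    (discreteE : forall A : set E, measurable A)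
    (Pi : R.-pker E ~> E)
    (P : E -> probability W R)
    (X : nat -> {mfun W >-> E})
    (xi : player -> nat -> {mfun W >-> R})
    (T : {mfun W >-> nat})
    (alpha : R) (alpha01 : 0 < alpha < 1)
    (f g h : player -> {mfun E >-> R})
    (markovX : markov_process P X Pi)
    (uniform_xi : uniform_randomizers P xi)
    (geometricT : geometric_killing P alpha T)
    (independent : independent_sources P X xi T)
    (integrable_f : forall i, sup_killed_integrable P X T (f i))
    (integrable_g : forall i, sup_killed_integrable P X T (g i))
    (integrable_h : forall i, sup_killed_integrable P X T (h i)) :
  exists p : player -> E -> R,
    global_markovian_randomized_equilibrium P X xi alpha f g h p.
Proof.
have alpha0 : 0 < alpha by case/andP: alpha01.
pose own i y := `|f i y| + `|g i y| + `|h i y|.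
pose m y := own true y + own false y.
have own0 i y : 0 <= own i y by rewrite !addr_ge0.
have m0 y : 0 <= m y by rewrite addr_ge0.
have ownm i y : own i y <= m y by case: i; rewrite /m ?lerDl ?lerDr.
have fm i y : `|f i y| <= m y.
  by rewrite (le_trans _ (ownm i y))// /own -addrA lerDl addr_ge0.
have gm i y : `|g i y| <= m y.
  by rewrite (le_trans _ (ownm i y))// /own addrAC lerDr addr_ge0.
have hm i y : `|h i y| <= m y.
  by rewrite (le_trans _ (ownm i y))// /own lerDr addr_ge0.
pose sup F w : \bar R :=
  ereal_sup [set `|extend_to_cemetery F (killed X T n w)|%:E | n in setT].
(* [X (T w) w] is the last state visited by the killed process. *)
have sup_ge F w : ((`|F (X (T w) w)|)%:E <= sup F w)%E.
  by apply: ereal_sup_ubound; exists (T w) => //; rewrite /killed leqnn.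
have sup0 F w : (0 <= sup F w)%E by apply: le_trans (sup_ge F w); rewrite lee_fin.
have finite x : (\sum_(k <oo) (alpha ^+ k)%:E * iterated_kernel Pi m k x < +oo)%E.
  apply: (potential_finite discreteE countableE markovX independent alpha01
    geometricT m0
    (Sup := fun w => (\sum_(i : bool) (sup (f i) w + sup (g i) w + sup (h i) w))%E)).
  - apply: integrable_sum => // i _; apply: integrableD => //; last exact: integrable_h.
    by apply: integrableD => //; [exact: integrable_f|exact: integrable_g].
  - by move=> w; apply: sume_ge0 => i _; rewrite !adde_ge0.
  - by move=> w; rewrite big_bool /m /own !EFinD; do !apply: leeD => //.
pose M := potential Pi alpha m.
have mM y : m y <= M y by exact: le_potential.
have iM y : (Pi y).-integrable setT (EFin \o M) by exact: integrable_potential.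
have sM y : alpha * (\int[Pi y]_z M z)%R <= M y.
  rewrite -lee_fin EFinM /Rintegral fineK; last exact: integrable_fin_num.
  exact: integral_potential.
have [p [V eq]] := stage_equilibrium discreteE (ltW alpha0) iM sM countableE
  (fun i y => le_trans (fm i y) (mM y)) (fun i y => le_trans (gm i y) (mM y))
  (fun i y => le_trans (hm i y) (mM y)).
have p01 i y : 0 <= p i y <= 1 by case: (eq i y).
exists p; split => [i|x i /=]; first by split => //; exact: measurable_discrete.
have iMX x' n : (P x').-integrable setT (fun w => (M (X n w))%:E).
  exact: (integrable_potential_at discreteE countableE markovX independent).
have tailM x' : alpha ^+ n * (\int[P x']_w M (X n w))%R @[n --> \oo] --> (0 : R).
  exact: (potential_tail discreteE countableE markovX independent).
have im := integrable_discounted_sum discreteE countableE markovX independent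
  alpha01 m0 finite x.
have M0 y : 0 <= M y by exact: le_trans (m0 y) (mM y).
have VM y : `|V i y| <= M y by case: (eq i y).
pose opponent := randomized_time X xi (~~ i) (p (~~ i)).
(* Against the opponent's strategy, [V i x] bounds all rewards and is attained. *)
have upper tau : stopping_times X xi i tau ->
    (reward P X alpha f g h i x tau opponent <= (V i x)%:E)%E.
  move=> st; apply: (expected_payoff_le discreteE countableE markovX uniform_xi
    independent alpha0 M0 iM sM iMX tailM (p01 (~~ i)) _ _ _ VM
    (fm i) (gm i) (hm i) im st).
  - by move=> y; exact: le_trans (fm i y) (mM y).
  - by move=> y; exact: le_trans (gm i y) (mM y).
  - by move=> y; exact: le_trans (hm i y) (mM y).
  - by move=> y; case: (eq i y).
  - by move=> y; case: (eq i y).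
have st_p : stopping_times X xi i (randomized_time X xi i (p i)).
  exact: randomized_time_stopping.
have attained :
    reward P X alpha f g h i x (randomized_time X xi i (p i)) opponent = (V i x)%:E.
  apply: (expected_payoff_eq discreteE countableE markovX uniform_xi
    independent alpha0 M0 iM sM iMX tailM (p01 (~~ i)) _ _ _ VM
    (fm i) (gm i) (hm i) im st_p (p01 i)) => //.
  - by move=> y; exact: le_trans (fm i y) (mM y).
  - by move=> y; exact: le_trans (gm i y) (mM y).
  - by move=> y; exact: le_trans (hm i y) (mM y).
  - by move=> y; case: (eq i y).
apply/eqP; rewrite eq_le; apply/andP; split.
  by apply: ereal_sup_ubound; exists (randomized_time X xi i (p i)).
by rewrite attained; apply: ge_ereal_sup => _ [tau st <-]; exact: upper.
Qed.
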